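(* Suppose that CEST generates an infinite sequence of iterates $\{\mathbf{x}_c\}$. Then $$\sum_{c=1}^{\infty}\|\mathbf{x}_{c+1}-\mathbf{x}_c\|<+\infty.$$ Hence the total sequence $\{\mathbf{x}_c\}$ has a finite length and converges to a unique stationary point, i.e. to a unique point $\mathbf{x}_*\in\mathbb{S}^{n-1}$, and $\mathbf{g}(\mathbf{x}_* )=0$.
   Context: Problem. For a $k$th order $n$-dimensional real symmetric tensor $\mathcal{T}=(t_{i_1\cdots i_k})$ and $\mathbf{x}\in\mathbb{R}^n$, $\mathcal{T}\mathbf{x}^k=\sum_{i_1,\ldots,i_k=1}^n t_{i_1\cdots i_k}x_{i_1}\cdots x_{i_k}$, and $\mathcal{T}\mathbf{x}^{k-1}\in\mathbb{R}^n$ has $i$th entry $\sum_{i_2,\ldots,i_k=1}^n t_{ii_2\cdots i_k}x_{i_2}\cdots x_{i_k}$. Let $k$ be even and $G=(V,E)$ a $k$-uniform hypergraph with $V=\{1,\ldots,n\}$, $E$ a set of distinct $k$-element subsets of $V$, every vertex lying in at least one edge; $d(i)$ is the number of edges containing $i$. The adjacency tensor $\mathcal{A}$ has entries $\frac{1}{(k-1)!}$ at $(i_1,\ldots,i_k)$ if $\{i_1,\ldots,i_k\}\in E$ and $0$ otherwise; $\mathcal{D}$ is the diagonal tensor with $i$th diagonal entry $d(i)$; $\mathcal{L}=\mathcal{D}-\mathcal{A}$, $\mathcal{Q}=\mathcal{D}+\mathcal{A}$. $\mathcal{T}$ is one of $\mathcal{A},\mathcal{L},\mathcal{Q}$; $\mathcal{B}$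 is a $k$th order $n$-dimensional real symmetric positive definite tensor ($\mathcal{B}\mathbf{x}^k>0$ for $\mathbf{x}\ne0$). $\mathbb{S}^{n-1}$ is the unit sphere of $\mathbb{R}^n$; $f(\mathbf{x})=\frac{\mathcal{T}\mathbf{x}^k}{\mathcal{B}\mathbf{x}^k}$ and $\mathbf{g}(\mathbf{x})=\nabla f(\mathbf{x})=\frac{k}{\mathcal{B}\mathbf{x}^k}\left(\mathcal{T}\mathbf{x}^{k-1}-\frac{\mathcal{T}\mathbf{x}^k}{\mathcal{B}\mathbf{x}^k}\mathcal{B}\mathbf{x}^{k-1}\right)$ for $\mathbf{x}\ne0$. A stationary point is $\mathbf{x}\in\mathbb{S}^{n-1}$ with $\mathbf{g}(\mathbf{x})=0$. Algorithm CEST. Parameters: positive integer $L$, $\eta\in(0,1)$, $\beta\in(0,1)$, $\kappa_\epsilon\in(0,1)$. Start from $\mathbf{x}_1\in\mathbb{S}^{n-1}$. For $c=1,2,\ldots$ (stopping if $\mathbf{g}(\mathbf{x}_c)=0$): (1) Set $\mathbf{p}_c=-H_c\mathbf{g}(\mathbf{x}_c)$, where $H_c$ is the L-BFGS matrix: $H_c^{(0)}=\gamma_cI$; for $\ell=L,L-1,\ldots,1$, $H_c^{(L-\ell+1)}=V_{c-\ell}^\top H_c^{(L-\ell)}V_{c-\ell}+\rho_{c-\ell}\mathbf{s}_{c-\ell}\mathbf{s}_{c-\ell}^\top$, where for $\ell\ge c$ one puts $\rho_{c-\ell}=0$ and the step does nothing; $H_c=H_c^{(L)}$. Here $\mathbf{y}_j=\mathbf{g}(\mathbf{x}_{j+1})-\mathbf{g}(\mathbf{x}_j)$,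 $\mathbf{s}_j=\mathbf{x}_{j+1}-\mathbf{x}_j$, $V_j=I-\rho_j\mathbf{y}_j\mathbf{s}_j^\top$, and $\rho_j=1/(\mathbf{y}_j^\top\mathbf{s}_j)$ if $\mathbf{y}_j^\top\mathbf{s}_j\ge\kappa_\epsilon$, $\rho_j=0$ otherwise. The scalar $\gamma_c$ is: $\gamma_1=1$; for $c\ge2$, $\gamma_c=1$ if $\mathbf{y}_{c-1}^\top\mathbf{s}_{c-1}<\kappa_\epsilon$, and otherwise $\gamma_c$ is one of $\frac{\mathbf{y}_{c-1}^\top\mathbf{s}_{c-1}}{\|\mathbf{y}_{c-1}\|^2}$, $\frac{\|\mathbf{s}_{c-1}\|^2}{\mathbf{y}_{c-1}^\top\mathbf{s}_{c-1}}$, $\frac{\|\mathbf{s}_{c-1}\|}{\|\mathbf{y}_{c-1}\|}$. (2) With $\mathbf{x}_{c+1}(\alpha)=\frac{[(1-\alpha\mathbf{x}_c^\top\mathbf{p}_c)^2-\|\alpha\mathbf{p}_c\|^2]\mathbf{x}_c+2\alpha\mathbf{p}_c}{1+\|\alpha\mathbf{p}_c\|^2-(\alpha\mathbf{x}_c^\top\mathbf{p}_c)^2}$, let $\ell$ be the smallest nonnegative integer such that $\alpha=\beta^\ell$ satisfies $f(\mathbf{x}_{c+1}(\alpha))\le f(\mathbf{x}_c)+\eta\alpha\,\mathbf{p}_c^\top\mathbf{g}(\mathbf{x}_c)$; set $\alpha_c=\beta^\ell$ and $\mathbf{x}_{c+1}=\mathbf{x}_{c+1}(\alpha_c)\in\mathbb{S}^{n-1}$.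 ''CEST generates an infinite sequence'' means $\mathbf{g}(\mathbf{x}_c)\ne0$ for all $c$. *)

(* Defs.v *)
From HB Require Import structures.
From mathcomp Require Import all_boot all_order all_algebra.
From mathcomp Require Import all_classical all_reals all_analysis.

Set Implicit Arguments.
Unset Strict Implicit.
Unset Printing Implicit Defensive.

Import Order.TTheory GRing.Theory Num.Theory.
Import numFieldNormedType.Exports.

Local Open Scope classical_set_scope.
Local Open Scope ring_scope.

Section Euclidean.
Context {R : realType} {n : nat}.
Implicit Types u v : 'cV[R]_n.

Definition dot u v : R := (u^T *m v) 0 0.

(* The library norm on matrices is the sup norm, hence this definition. *)
Definition enorm u : R := Num.sqrt (dot u u).

Definition on_sphere u : Prop := enorm u = 1.

End Euclidean.

Notation tensor R k n := {ffun k.-tuple 'I_n -> R}.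

Section Tensor.
Context {R : realType} {k n : nat}.
Implicit Types (T B : tensor R k n) (x : 'cV[R]_n).

Definition tensor_sym T : Prop :=
  forall s t : k.-tuple 'I_n, perm_eq s t -> T s = T t.

(* T x^k *)
Definition tform T x : R :=
  \sum_(j : k.-tuple 'I_n) T j * \prod_(l <- j) x l 0.

(* T x^(k-1): the first index is fixed to i, the k - 1 others are summed *)
Definition tgrad T x : 'cV[R]_n :=
  \col_i \sum_(j : k.-tuple 'I_n | ohead j == Some i)
           T j * \prod_(l <- behead j) x l 0.

Definition tensor_posdef T : Prop :=
  forall x, x != 0 -> 0 < tform T x.

Definition diag_tensor (d : 'I_n -> R) : tensor R k n :=
  [ffun j : k.-tuple 'I_n =>
     (if tval j is i :: s then (if all (pred1 i) s then d i else 0) else 0) : R].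

Definition quot T B x : R := tform T x / tform B x.

(* The gradient of quot T B at x != 0, for symmetric T and B *)
Definition quot_grad T B x : 'cV[R]_n :=
  (k%:R / tform B x) *:
    (tgrad T x - (tform T x / tform B x) *: tgrad B x).

Definition stationary T B x : Prop := on_sphere x /\ quot_grad T B x = 0.

End Tensor.

Section Hypergraph.
Context {n : nat}.
Implicit Type E : {set {set 'I_n}}.

Definition uniform_hypergraph (k : nat) E : Prop :=
  (forall e, e \in E -> #|e| = k) /\
  (forall i : 'I_n, exists2 e, e \in E & i \in e).

Definition hdegree E (i : 'I_n) : nat := #|[set e in E | i \in e]%SET|.

Variables (R : realType) (k : nat).

Definition adj_tensor E : tensor R k n :=
  [ffun j : k.-tuple 'I_n =>
     (if [set i in j]%SET \in E then ((k.-1)`!%:R)^-1 else 0) : R].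

Definition deg_tensor E : tensor R k n :=
  diag_tensor (fun i => (hdegree E i)%:R).

Definition lap_tensor E : tensor R k n := deg_tensor E - adj_tensor E.

Definition slap_tensor E : tensor R k n := deg_tensor E + adj_tensor E.

End Hypergraph.

(* Sequences of iterates are indexed from 1; the value at 0 is irrelevant. *)
Section LBFGS.
Context {R : realType} {n : nat}.
Variables (g : 'cV[R]_n -> 'cV[R]_n) (x : nat -> 'cV[R]_n) (kappa : R).

Definition yvec (j : nat) : 'cV[R]_n := g (x j.+1) - g (x j).

Definition svec (j : nat) : 'cV[R]_n := x j.+1 - x j.

Definition rho (j : nat) : R :=
  if kappa <= dot (yvec j) (svec j) then (dot (yvec j) (svec j))^-1 else 0.

Definition Vmat (j : nat) : 'M[R]_n :=
  1%:M - rho j *: (yvec j *m (svec j)^T).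

Variables (L : nat) (gamma : nat -> R).

(* H_c^(m); the step from m to m + 1 is the one with l = L - m. *)
Fixpoint lbfgs_iter (c m : nat) : 'M[R]_n :=
  if m is m'.+1 then
    let H := lbfgs_iter c m' in
    let l := (L - m')%N in
    if (l < c)%N then
      (Vmat (c - l))^T *m H *m Vmat (c - l)
      + rho (c - l) *: (svec (c - l) *m (svec (c - l))^T)
    else H
  else (gamma c)%:M.

Definition lbfgs (c : nat) : 'M[R]_n := lbfgs_iter c L.

(* Each gamma c may use any of the three formulas, independently of the
   others. *)
Definition gamma_rule : Prop :=
  gamma 1%N = 1 /\
  forall c, (2 <= c)%N ->
    let y := yvec c.-1 in
    let s := svec c.-1 in
    if dot y s < kappa then gamma c = 1
    else [\/ gamma c = dot y s / enorm y ^+ 2,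
             gamma c = enorm s ^+ 2 / dot y s
           | gamma c = enorm s / enorm y].

Definition direction (c : nat) : 'cV[R]_n := - (lbfgs c *m g (x c)).

End LBFGS.

Section CEST.
Context {R : realType} {k n : nat}.
Variables (T B : tensor R k n).

Definition curve (x p : 'cV[R]_n) (a : R) : 'cV[R]_n :=
  (1 + enorm (a *: p) ^+ 2 - (a * dot x p) ^+ 2)^-1 *:
    (((1 - a * dot x p) ^+ 2 - enorm (a *: p) ^+ 2) *: x + (2 * a) *: p).

Definition armijo (eta : R) (x p : 'cV[R]_n) (a : R) : bool :=
  quot T B (curve x p a)
    <= quot T B x + eta * a * dot p (quot_grad T B x).

(* x is an infinite sequence of iterates, for the choice gamma of the
   initial scalings. *)
Definition CEST_infinite (L : nat) (eta beta kappa : R)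
    (gamma : nat -> R) (x : nat -> 'cV[R]_n) : Prop :=
  let g := quot_grad T B in
  let p := direction g x kappa L gamma in
  [/\ on_sphere (x 1%N),
      gamma_rule g x kappa gamma,
      forall c, (1 <= c)%N -> g (x c) <> 0
    & forall c, (1 <= c)%N ->
        exists l : nat,
          [/\ armijo eta (x c) (p c) (beta ^+ l),
              forall m, (m < l)%N -> ~~ armijo eta (x c) (p c) (beta ^+ m)
            & x c.+1 = curve (x c) (p c) (beta ^+ l)]].

End CEST.

(* Main.v *)
(* The quotient f and its gradient are semialgebraic, so by quantifier
   elimination over a real closed field a definable subset of the line is, near
   0+, either everything or nothing. Over a complete field this yields the
   monotonicity theorem for germs at 0+ of definable functions. Choose definably
   in each level {f = f_* + t} of the sphere a point z(t) where the gradient norm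
   is least, say h(t). Its coordinates and h are monotone near 0+, and
   the first-order expansion of f gives
   v - u <= C (h(v) |z(v) - z(u)| + |z(v) - z(u)|^2); subdividing [s, t] shows
   t - s <= 2 C h(t) (V t - V s), where V is the sum of the
   coordinates of z, signed so as to be nondecreasing.
   This is the Kurdyka-Lojasiewicz inequality with desingularizing function V.
   The L-BFGS matrices are uniformly bounded and positive definite, so Armijo's
   rule gives a decrease of f of order |g(x_c)| |x_{c+1} - x_c|, and the lengths
   are bounded by a telescoping sum of V. Step lengths are bounded below, which
   makes the limit stationary. *)
Require Import Defs.
From HB Require Import structures.
From mathcomp Require Import all_boot all_order all_algebra.
From mathcomp Require Import all_classical all_reals all_analysis.
From mathcomp Require Import ring lra.
From mathcomp.real_closed Require ordered_qelim qe_rcf polyrcf.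
Import Order.TTheory GRing.Theory Num.Theory.
Import numFieldNormedType.Exports.
Local Open Scope classical_set_scope.
Local Open Scope ring_scope.

Module ord := ordered_qelim.ord.

Set Implicit Arguments.
Unset Strict Implicit.
Unset Printing Implicit Defensive.

(** * Definable sets and germs at 0+ *)

(** The inequality is attached to the limit value [f_*] on the whole sphere rather than to a limit
    point, so it is available before the iterates are known to converge. Minimizing the gradient
    norm on each level is what carries an estimate along one selection over to every point of that
    level. The selected points are only known to be monotone coordinate by coordinate, possibly with
    jumps, so there is no derivative to integrate: the expansion between two levels, on a fine
    subdivision, replaces the chain rule. The bound by [h(t)] supposes that [h] grows with [t]; in
    the other case [h] stays above a positive constant near 0 and a linear function desingularizes.
    Selection asks for polynomial data, so [h] is built from a polynomial multiple of the gradient,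
    comparable with it on the sphere. *)

Section Definable.
Context {R : realType}.
Implicit Types (P Q : seq R -> Prop) (u v : seq R -> R) (e : seq R).

(** Predicates on whole environments are judged by their meaning, so that closure lemmas replace
    work on syntax. Real constants are allowed as parameters. *)
Definition definable P := exists f : ord.formula R, forall e, ord.holds e f <-> P e.

Definition definable_term u := exists t : GRing.term R, forall e, GRing.eval e t = u e.

Lemma definable_ext P Q : (forall e, P e <-> Q e) -> definable P -> definable Q.
Proof. by move=> PQ [f fP]; exists f => e; rewrite fP. Qed.

Lemma term_var i : definable_term (fun e => e`_i).
Proof. by exists (GRing.Var R i). Qed.

Lemma term_const c : definable_term (fun=> c).
Proof. by exists (GRing.Const c). Qed.

Lemma term_add u v : definable_term u -> definable_term v ->
  definable_term (fun e => u e + v e).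
Proof. by move=> [a ua] [b vb]; exists (GRing.Add a b) => e /=; rewrite ua vb. Qed.

Lemma term_mul u v : definable_term u -> definable_term v ->
  definable_term (fun e => u e * v e).
Proof. by move=> [a ua] [b vb]; exists (GRing.Mul a b) => e /=; rewrite ua vb. Qed.

Lemma term_inv u : definable_term u -> definable_term (fun e => (u e)^-1).
Proof. by move=> [a ua]; exists (GRing.Inv a) => e /=; rewrite ua. Qed.

Lemma definable_eq u v : definable_term u -> definable_term v ->
  definable (fun e => u e = v e).
Proof. by move=> [a ua] [b vb]; exists (ord.Equal a b) => e /=; rewrite ua vb. Qed.

Lemma definable_lt u v : definable_term u -> definable_term v ->
  definable (fun e => u e < v e).
Proof. by move=> [a ua] [b vb]; exists (ord.Lt a b) => e /=; rewrite ua vb. Qed.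

Lemma definable_le u v : definable_term u -> definable_term v ->
  definable (fun e => u e <= v e).
Proof. by move=> [a ua] [b vb]; exists (ord.Le a b) => e /=; rewrite ua vb. Qed.

Lemma definable_and P Q : definable P -> definable Q ->
  definable (fun e => P e /\ Q e).
Proof. by move=> [f fP] [g gQ]; exists (ord.And f g) => e /=; rewrite fP gQ. Qed.

Lemma definable_imp P Q : definable P -> definable Q ->
  definable (fun e => P e -> Q e).
Proof. by move=> [f fP] [g gQ]; exists (ord.Implies f g) => e /=; rewrite fP gQ. Qed.

Lemma definable_not P : definable P -> definable (fun e => ~ P e).
Proof. by move=> [f fP]; exists (ord.Not f) => e /=; rewrite fP. Qed.

Lemma definable_ex i P : definable P ->
  definable (fun e => exists x, P (set_nth 0 e i x)).
Proof.
move=> [f fP]; exists (ord.Exists i f) => e /=.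
by split=> -[x /fP ?]; exists x.
Qed.

Lemma definable_all i P : definable P ->
  definable (fun e => forall x, P (set_nth 0 e i x)).
Proof.
move=> [f fP]; exists (ord.Forall i f) => e /=.
by split=> + x => /(_ x) /fP.
Qed.

Lemma definable_same_env P e e' : definable P -> GRing.same_env e e' -> P e -> P e'.
Proof. by move=> [f fP] ee' /fP h; apply/fP; exact: ord.eq_holds ee' h. Qed.

(** [to_rform] trades inverses for quantified variables before quantifiers are eliminated, so the
    remaining atoms compare polynomials. *)
Lemma qf_elim P : definable P ->
  exists2 f : ord.formula R, ord.qf_form f && ord.rformula f
    & forall e, ord.qf_eval e f <-> P e.
Proof.
move=> [f fP]; pose pr i bc : ord.formula R := qe_rcf.qfr_to_formula (@qe_rcf.wproj R i bc).
exists (ord.quantifier_elim pr (ord.to_rform f)).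
  by apply: ord.quantifier_elim_wf; [exact: qe_rcf.wf_QE_wproj|exact: ord.to_rform_rformula].
by move=> e; rewrite -fP; split=> /(@qe_rcf.rcf_satP R e f).
Qed.

(** Variable 0 becomes the indeterminate; the tail [e] is frozen into the coefficients. *)
Lemma rterm_polynomial e (t : GRing.term R) : GRing.rterm t ->
  exists p : {poly R}, forall x, GRing.eval (x :: e) t = p.[x].
Proof.
elim: t => //=.
- case=> [|i] _; first by exists 'X => x; rewrite hornerX.
  by exists (e`_i)%:P => x; rewrite hornerC.
- by move=> c _; exists c%:P => x; rewrite hornerC.
- by move=> m _; exists m%:R%:P => x; rewrite hornerC.
- move=> a IHa b IHb /andP[/IHa[p pP] /IHb[q qP]].
  by exists (p + q) => x; rewrite hornerD pP qP.
- by move=> a IHa /IHa[p pP]; exists (- p) => x; rewrite hornerN pP.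
- by move=> a IHa m /IHa[p pP]; exists (p *+ m) => x; rewrite hornerMn pP.
- move=> a IHa b IHb /andP[/IHa[p pP] /IHb[q qP]].
  by exists (p * q) => x; rewrite hornerM pP qP.
- by move=> a IHa m /IHa[p pP]; exists (p ^+ m) => x; rewrite horner_exp pP.
Qed.

Definition decided_at0 (P : R -> Prop) :=
  (\forall t \near 0^'+, P t) \/ (\forall t \near 0^'+, ~ P t).

Lemma poly_sign_near0 (p : {poly R}) :
  [\/ p = 0, \forall t \near 0^'+, 0 < p.[t] | \forall t \near 0^'+, p.[t] < 0].
Proof.
have [->|p0] := eqVneq p 0; first by constructor.
(* [next_root p 0 1] is the first root in ]0, 1[, or 1 if there is none, so [p] keeps a constant
   sign before it. *)
have nr1 : 0 < polyrcf.next_root p 0 1 by exact: polyrcf.next_root_gt.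
have noroot := @polyrcf.next_noroot R p 0 1.
set d := polyrcf.next_root p 0 1 in nr1 noroot.
have d2 : d / 2 \in `]0, d[ by rewrite in_itv/= divr_gt0//= gtr_pMr// invf_lt1// ltr1n.
have sg x : x \in `]0, d[ -> Num.sg p.[x] = Num.sg p.[d / 2].
  move=> xd; apply: (polyrcf.polyrN0_itv noroot) => //.
have near_d : \forall t \near 0^'+, t \in `]0, d[.
  by near=> t; rewrite in_itv/=; apply/andP; split; near: t;
    [exact: nbhs_right_gt|exact: nbhs_right_lt].
have [h|h|h] := ltgtP 0 p.[d / 2].
- constructor 2; near=> t; rewrite -sgr_gt0 sg ?sgr_gt0//; near: t; exact: near_d.
- constructor 3; near=> t; rewrite -sgr_lt0 sg ?sgr_lt0//; near: t; exact: near_d.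
- by have := noroot _ d2; rewrite /root -h eqxx.
Unshelve. all: by end_near. Qed.

(** Induction on a quantifier-free equivalent: an atom compares two polynomials in variable 0, whose
    difference has a constant sign near 0+, and connectives preserve being decided because the
    neighbourhoods form a filter. *)
Lemma definable_decided P e : definable P -> decided_at0 (fun t => P (t :: e)).
Proof.
move=> /qf_elim[f]; move: P => P fr fP.
suff : decided_at0 (fun t => ord.qf_eval (t :: e) f).
  by case=> h; [left|right]; apply: filterS h => t h; [exact/fP|move=> /fP].
elim: f {P fP} fr => //=.
- by case=> _; [left|right]; apply: nearW.
- move=> a b /andP[/(@rterm_polynomial e)[p pP] /(@rterm_polynomial e)[q qP]].
  have [pq|h|h] := poly_sign_near0 (p - q).
  + left; apply: nearW => t; rewrite pP qP; apply/eqP.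
    by apply/eqP; rewrite -subr_eq0 -hornerN -hornerD pq horner0.
  + right; apply: filterS h => t; rewrite pP qP hornerD hornerN subr_gt0 => h.
    by apply/negP; rewrite gt_eqF.
  + right; apply: filterS h => t; rewrite pP qP hornerD hornerN subr_lt0 => h.
    by apply/negP; rewrite lt_eqF.
- move=> a b /andP[/(@rterm_polynomial e)[p pP] /(@rterm_polynomial e)[q qP]].
  have [pq|h|h] := poly_sign_near0 (q - p).
  + right; apply: nearW => t; rewrite pP qP; apply/negP.
    by rewrite -subr_gt0 -hornerN -hornerD pq horner0 ltxx.
  + by left; apply: filterS h => t; rewrite pP qP hornerD hornerN subr_gt0.
  + right; apply: filterS h => t; rewrite pP qP hornerD hornerN subr_lt0 => h.
    by apply/negP; rewrite -leNgt ltW.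
- move=> a b /andP[/(@rterm_polynomial e)[p pP] /(@rterm_polynomial e)[q qP]].
  have [pq|h|h] := poly_sign_near0 (q - p).
  + left; apply: nearW => t; rewrite pP qP.
    by rewrite -subr_ge0 -hornerN -hornerD pq horner0.
  + by left; apply: filterS h => t; rewrite pP qP hornerD hornerN subr_gt0 => /ltW.
  + right; apply: filterS h => t; rewrite pP qP hornerD hornerN subr_lt0 => h.
    by apply/negP; rewrite -ltNge.
- move=> f IHf g IHg /andP[/andP[qf qg] /andP[rf rg]].
  have [|hf|hf] := IHf; first by rewrite qf.
    have [|hg|hg] := IHg; first by rewrite qg.
      by left; near=> t; apply/andP; split; near: t.
    by right; apply: filterS hg => t hg /andP[].
  by right; apply: filterS hf => t hf /andP[].
- move=> f IHf g IHg /andP[/andP[qf qg] /andP[rf rg]].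
  have [|hf|hf] := IHf; first by rewrite qf.
    by left; apply: filterS hf => t ->.
  have [|hg|hg] := IHg; first by rewrite qg.
    by left; apply: filterS hg => t ->; rewrite orbT.
  by right; apply: filterS2 hf hg => t hf hg /orP[].
- move=> f IHf g IHg /andP[/andP[qf qg] /andP[rf rg]].
  have [|hg|hg] := IHg; first by rewrite qg.
    by left; apply: filterS hg => t ->; rewrite implybT.
  have [|hf|hf] := IHf; first by rewrite qf.
    by right; apply: filterS2 hf hg => t -> hg.
  by left; apply: filterS hf => t /negP/negbTE ->.
- move=> f IHf /IHf[] h; [right|left]; apply: filterS h => t; first by move=> ->.
  by move/negP.
Unshelve. all: by end_near. Qed.

End Definable.

(** * The monotonicity theorem *)

Section Monotonicity.
Context {R : realType}.
Implicit Types (a : R -> R) (C : R -> R -> Prop).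

Lemma near0P (P : R -> Prop) :
  (\forall t \near 0^'+, P t) <-> exists2 d : R, 0 < d & forall t : R, 0 < t < d -> P t.
Proof.
split.
  case => d /= d0 h; exists d => // t /andP[t0 td]; apply: h => //=.
  by rewrite sub0r normrN gtr0_norm.
move=> [d d0 h]; near=> t; apply: h; apply/andP; split; near: t.
  exact: nbhs_right_gt.
exact: nbhs_right_lt.
Unshelve. all: by end_near. Qed.

(** With [s] fixed, take the longest interval from [s] on which [a s] is a lower bound: the left
    condition puts its supremum in it, and the right condition pushes it past any supremum short of
    [t]. *)
Lemma locally_nondecreasing a (eps : R) :
  (forall t : R, 0 < t < eps ->
     exists2 d : R, 0 < d & forall u, 0 < u < d -> a t <= a (t + u)) ->
  (forall t : R, 0 < t < eps ->
     exists2 d : R, 0 < d & forall u, 0 < u < d -> a (t - u) <= a t) ->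
  forall s t, 0 < s -> s <= t -> t < eps -> a s <= a t.
Proof.
move=> rgt lft s t s0 st te.
pose A := [set r | s <= r <= t /\ forall q, s <= q <= r -> a s <= a q].
have As : A s by split; [rewrite lexx|move=> q; rewrite -eq_le => /eqP ->].
have ubA : ubound A t by move=> r [/andP[]].
have supA : has_sup A by split; [exists s|exists t].
have ss : s <= sup A by apply: ub_le_sup => //; exists t.
have supt : sup A <= t by apply: ge_sup => //; exists s.
have below q : s <= q -> q < sup A -> a s <= a q.
  move=> sq qs; have [r [_ Ar] qr] := sup_gt (ex_intro _ s As) qs.
  by apply: Ar; rewrite sq ltW.
have sup0 : 0 < sup A < eps by rewrite (lt_le_trans s0)//= (le_lt_trans supt).
have Asup : a s <= a (sup A).
  have [<-//|ns] := eqVneq s (sup A).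
  have lts : s < sup A by rewrite lt_neqAle ns.
  have [d d0 dP] := lft _ sup0.
  have [u /andP[u0 uP]] : exists u, 0 < u < Num.min d (sup A - s).
    have : 0 < Num.min d (sup A - s) by rewrite lt_min d0 subr_gt0.
    by move: (Num.min _ _) => m m0; exists (m / 2); lra.
  move: uP; rewrite lt_min => /andP[ud us].
  apply: (le_trans (below (sup A - u) _ _)); [lra|lra|].
  by apply: dP; rewrite u0.
have [<-//|nt] := eqVneq (sup A) t.
have ltt : sup A < t by rewrite lt_neqAle nt.
have [d d0 dP] := rgt _ sup0.
pose r := sup A + Num.min (d / 2) (t - sup A).
have m0 : 0 < Num.min (d / 2) (t - sup A) by rewrite lt_min divr_gt0//= subr_gt0.
have mt : Num.min (d / 2) (t - sup A) <= t - sup A by rewrite ge_min lexx orbT.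
have md : Num.min (d / 2) (t - sup A) <= d / 2 by rewrite ge_min lexx.
suff : A r by move/(ub_le_sup (ex_intro _ t ubA)); rewrite /r; lra.
split; first by rewrite /r; lra.
move=> q /andP[sq qr]; have [qs|qs] := ltP q (sup A); first exact: below.
have [->//|nq] := eqVneq q (sup A).
have q1 : sup A < q by rewrite lt_neqAle eq_sym nq.
rewrite (le_trans Asup)// -(subrKC (sup A) q); apply: dP.
rewrite /r in qr; lra.
Qed.

(** Give each [t] a radius 1/(m+1) of strict minimality. Two points with the same [m] in the same
    cell of mesh 1/(m+1) lie within each other's radius, so each value would be below the other.
    Hence the interval injects into a countable set, although its measure is positive. *)
Lemma no_everywhere_strict_min a (eps : R) : 0 < eps ->
  ~ (forall t : R, 0 < t < eps ->
     exists2 d : R, 0 < d & forall s : R, s != t -> `|s - t| < d -> a t < a s).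
Proof.
move=> eps0 smin.
have rad (t : R) : exists m : nat, 0 < t < eps ->
    forall s : R, s != t -> `|s - t| < m.+1%:R^-1 -> a t < a s.
  have [te|te] := boolP (0 < t < eps); last by exists 0%N.
  have [d d0 dP] := smin _ te.
  exists (Num.trunc d^-1) => _ s st h; apply: dP => //.
  rewrite (lt_trans h)// invf_plt ?posrE//.
  by rewrite truncnS_gt// .
have [m mP] := choice rad.
pose code (t : R) : nat * int := (m t, Num.floor (t * (m t).+1%:R)).
have : countable [set` `]0, eps[].
  apply/pcard_injP; exists (pickle \o code) => s t.
  rewrite !inE/= !in_itv/= => se te /(pcan_inj pickleK)[mst fst_].
  apply/eqP; apply/negPn/negP => nst.
  have dst : `|s - t| < (m t).+1%:R^-1.
    have m0 : (0 : R) < (m t).+1%:R by rewrite ltr0n.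
    rewrite -(ltr_pM2r m0) mulVf ?gt_eqF// -[X in _ * X](gtr0_norm m0) -normrM mulrBl.
    have /andP[] := floor_itv (t * (m t).+1%:R).
    have := floor_itv (s * (m s).+1%:R); rewrite fst_ mst => /andP[].
    rewrite intrD ltr_norml; move: (_%:~R) => z; lra.
  have h1 : a t < a s by apply: mP.
  have h2 : a s < a t.
    by apply: mP => //; [rewrite eq_sym|rewrite distrC mst].
  by have := lt_trans h1 h2; rewrite ltxx.
move/countable_lebesgue_measure0; rewrite lebesgue_measure_itv/= lte_fin eps0.
by rewrite oppr0 adde0 => -[] /eqP; rewrite gt_eqF.
Qed.

Definition definable_graph a :=
  forall i j, i != j -> definable (fun e : seq R => e`_j = a e`_i).

(* sigma = 1 or -1 selects the side of t. *)
Definition germ a C (sigma t : R) :=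
  exists2 d, 0 < d & forall u, 0 < u < d -> C (a t) (a (t + sigma * u)).

Definition definable_cmp C := forall i j, definable (fun e : seq R => C e`_i e`_j).

Lemma definable_germ a C sigma : definable_graph a -> definable_cmp C ->
  definable (fun e => germ a C sigma e`_0).
Proof.
move=> ga dC.
(* Variable 0 is [t], 1 the radius, 2 the offset. Variables 3, 4, 5 hold [a t], the moved point and
   its value; they are quantified because [a] is reachable only through its graph. *)
pose Q (e : seq R) := 0 < e`_2 -> e`_2 < e`_1 ->
  exists x y z, [/\ x = a e`_0, y = e`_0 + sigma * e`_2, z = a y & C x z].
have dQ : definable Q.
  apply: definable_imp; first by apply: definable_lt; [exact: term_const|exact: term_var].
  apply: definable_imp; first by apply: definable_lt; exact: term_var.
  pose G (e : seq R) :=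
    (e`_3 = a e`_0 /\ e`_4 = e`_0 + sigma * e`_2) /\ (e`_5 = a e`_4 /\ C e`_3 e`_5).
  have dG : definable (fun e => exists x y z,
      G (set_nth 0 (set_nth 0 (set_nth 0 e 3 x) 4 y) 5 z)).
    apply: (@definable_ex _ 3 (fun e => exists y z, G (set_nth 0 (set_nth 0 e 4 y) 5 z))).
    apply: (@definable_ex _ 4 (fun e => exists z, G (set_nth 0 e 5 z))).
    apply: (@definable_ex _ 5 G).
    apply: definable_and; apply: definable_and.
    - exact: ga.
    - apply: definable_eq; first exact: term_var.
      apply: term_add; first exact: term_var.
      by apply: term_mul; [exact: term_const|exact: term_var].
    - exact: ga.
    - exact: dC.
  apply: definable_ext dG => e.
  split=> -[x [y [z h]]]; exists x, y, z; move: h;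
    rewrite /G !nth_set_nth/= !nth_set_nth/= !nth_set_nth/=.
    by move=> [] [? ?] [? ?].
  by case.
have dall : definable (fun e => 0 < e`_1 /\ forall u, Q (set_nth 0 e 2 u)).
  apply: definable_and; last exact: definable_all.
  by apply: definable_lt; [exact: term_const|exact: term_var].
apply: definable_ext (definable_ex 1 dall) => e; rewrite /Q.
split=> -[d].
  rewrite nth_set_nth/= => -[d0 h]; exists d => // u /andP[u0 ud].
  have := h u; rewrite !nth_set_nth/= !nth_set_nth/= => /(_ u0 ud)[x [y [z [-> -> ->]]]].
  by [].
move=> d0 h; exists d; rewrite nth_set_nth/=; split=> // u.
rewrite !nth_set_nth/= !nth_set_nth/= => u0 ud.
exists (a e`_0), (e`_0 + sigma * u), (a (e`_0 + sigma * u)); split=> //.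
by apply: h; rewrite u0.
Qed.

(** Unlike in [definable_germ], here [t] is frozen and the offset, placed in variable 0, tends to
    0. *)
Lemma germ_decided a C sigma t : definable_graph a -> definable_cmp C ->
  decided_at0 (fun u => C (a t) (a (t + sigma * u))).
Proof.
move=> ga dC.
pose G (e : seq R) :=
  (e`_2 = a e`_1 /\ e`_3 = e`_1 + sigma * e`_0) /\ (e`_4 = a e`_3 /\ C e`_2 e`_4).
pose Q (e : seq R) := exists x y z,
  G (set_nth 0 (set_nth 0 (set_nth 0 e 2 x) 3 y) 4 z).
have dQ : definable Q.
  apply: (@definable_ex _ 2 (fun e => exists y z, G (set_nth 0 (set_nth 0 e 3 y) 4 z))).
  apply: (@definable_ex _ 3 (fun e => exists z, G (set_nth 0 e 4 z))).
  apply: (@definable_ex _ 4 G).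
  apply: definable_and; apply: definable_and.
  - exact: ga.
  - apply: definable_eq; first exact: term_var.
    apply: term_add; first exact: term_var.
    by apply: term_mul; [exact: term_const|exact: term_var].
  - exact: ga.
  - exact: dC.
have QE u : Q [:: u; t] <-> C (a t) (a (t + sigma * u)).
  split; first by move=> [x [y [z /= [[-> ->] [->]]]]].
  by move=> h; exists (a t), (t + sigma * u), (a (t + sigma * u)).
by have [h|h] := definable_decided [:: t] dQ; [left|right];
  apply: filterS h => u; rewrite QE.
Qed.

Lemma definable_cmp_lt : definable_cmp (fun x y => x < y).
Proof. by move=> i j; apply: definable_lt; exact: term_var. Qed.

Lemma definable_cmp_gt : definable_cmp (fun x y => y < x).
Proof. by move=> i j; apply: definable_lt; exact: term_var. Qed.

Lemma definable_cmp_eq : definable_cmp (fun x y => x = y).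
Proof. by move=> i j; apply: definable_eq; exact: term_var. Qed.

(** Decidability is used twice. If no germ held near 0+, some [t] would refute all three; at that
    [t] each comparison is decided in the offset, hence fails for all small offsets, against
    totality of the order. *)
Lemma germ_trichotomy a sigma : definable_graph a ->
  [\/ \forall t \near 0^'+, germ a (fun x y => x < y) sigma t,
      \forall t \near 0^'+, germ a (fun x y => x = y) sigma t
    | \forall t \near 0^'+, germ a (fun x y => y < x) sigma t].
Proof.
move=> ga.
have key C : definable_cmp C -> decided_at0 (germ a C sigma).
  by move=> dC; exact: (definable_decided [::] (definable_germ sigma ga dC)).
have [|h1] := key _ definable_cmp_lt; first by constructor.
have [|h2] := key _ definable_cmp_eq; first by constructor.
have [|h3] := key _ definable_cmp_gt; first by constructor.
have [t [n1 n2 n3]] : exists t, [/\ ~ germ a (fun x y => x < y) sigma t,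
    ~ germ a (fun x y => x = y) sigma t & ~ germ a (fun x y => y < x) sigma t].
  have h : \forall t \near (0:R)^'+, [/\ ~ germ a (fun x y => x < y) sigma t,
    ~ germ a (fun x y => x = y) sigma t & ~ germ a (fun x y => y < x) sigma t].
    by near=> t; split; near: t.
  by have [t ?] := @filter_ex _ _ (at_right_proper_filter 0) _ h; exists t.
have nlt C : definable_cmp C -> ~ germ a C sigma t ->
    \forall u \near 0^'+, ~ C (a t) (a (t + sigma * u)).
  by move=> dC nC; case: (germ_decided sigma t ga dC) => // /near0P.
have h : \forall u \near (0:R)^'+, False.
  have c1 := nlt _ definable_cmp_lt n1.
  have c2 := nlt _ definable_cmp_eq n2.
  have c3 := nlt _ definable_cmp_gt n3.
  by apply: filterS3 c1 c2 c3 => u; have [] := ltgtP (a t) (a (t + sigma * u)).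
by have [] := @filter_ex _ _ (at_right_proper_filter 0) _ h.
Unshelve. all: by end_near. Qed.

Definition monotone_near0 a := exists2 eps : R, 0 < eps &
  (forall s t, 0 < s -> s <= t -> t < eps -> a s <= a t) \/
  (forall s t, 0 < s -> s <= t -> t < eps -> a t <= a s).

Lemma germ_nondecreasing a :
  (\forall t \near 0^'+, germ a (fun x y => x <= y) 1 t) ->
  (\forall t \near 0^'+, germ a (fun x y => y <= x) (-1) t) ->
  exists2 eps : R, 0 < eps & forall s t, 0 < s -> s <= t -> t < eps -> a s <= a t.
Proof.
move=> h1 h2; have [eps eps0 h] := (near0P _).1 (filterI h1 h2).
exists eps => //; apply: locally_nondecreasing => t /h[[d d0 dP] [d' d'0 d'P]].
  by exists d => // u /dP; rewrite mul1r.
by exists d' => // u /d'P; rewrite mulN1r.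
Qed.

Lemma germ_weaken a C C' sigma : (forall x y, C x y -> C' x y) ->
  (\forall t \near 0^'+, germ a C sigma t) -> \forall t \near 0^'+, germ a C' sigma t.
Proof.
move=> CC'; apply: filterS => t [d d0 dP]; exists d => // u /dP; exact: CC'.
Qed.

Lemma germ_opp a C sigma :
  (\forall t \near 0^'+, germ a C sigma t) ->
  \forall t \near 0^'+, germ (\- a) (fun x y => C (- x) (- y)) sigma t.
Proof.
by apply: filterS => t [d d0 dP]; exists d => // u /dP; rewrite !opprK.
Qed.

Lemma germ_min_false a :
  (\forall t \near 0^'+, germ a (fun x y => x < y) 1 t) ->
  (\forall t \near 0^'+, germ a (fun x y => x < y) (-1) t) -> False.
Proof.
move=> h1 h2; have [eps eps0 h] := (near0P _).1 (filterI h1 h2).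
apply: (@no_everywhere_strict_min a eps eps0) => t /h[[d d0 dP] [d' d'0 d'P]].
exists (Num.min d d'); first by rewrite lt_min d0.
move=> s st; rewrite lt_min => /andP[sd sd'].
have [ts|ts|ts] := ltgtP t s; last by rewrite ts eqxx in st.
  have := dP (s - t); rewrite mul1r subrKC; apply.
  by rewrite subr_gt0 ts -[X in X < _]gtr0_norm// subr_gt0.
have := d'P (t - s); rewrite mulN1r opprB subrKC; apply.
by rewrite subr_gt0 ts -[X in X < _]gtr0_norm ?subr_gt0// distrC.
Qed.

(** Of the nine pairs of right and left germs, seven give weak monotonicity. The other two make
    every point near 0+ a strict local minimum, or a strict local maximum, which is the first case
    for [\- a]. *)
Theorem definable_monotone a : definable_graph a -> monotone_near0 a.
Proof.
move=> ga.
have up : (\forall t \near 0^'+, germ a (fun x y => x <= y) 1 t) ->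
    (\forall t \near 0^'+, germ a (fun x y => y <= x) (-1) t) -> monotone_near0 a.
  by move=> h1 h2; have [eps eps0 h] := germ_nondecreasing h1 h2; exists eps => //; left.
have down : (\forall t \near 0^'+, germ a (fun x y => y <= x) 1 t) ->
    (\forall t \near 0^'+, germ a (fun x y => x <= y) (-1) t) -> monotone_near0 a.
  move=> /germ_opp h1 /germ_opp h2.
  have [||eps eps0 h] := @germ_nondecreasing (\- a).
  - by apply: germ_weaken h1 => x y; rewrite lerN2.
  - by apply: germ_weaken h2 => x y; rewrite lerN2.
  by exists eps => //; right=> s t s0 st te; rewrite -lerN2; exact: h.
have lte (x y : R) : x < y -> x <= y by exact: ltW.
have gte (x y : R) : y < x -> y <= x by exact: ltW.
have eqle (x y : R) : x = y -> x <= y by move=> ->.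
have eqge (x y : R) : x = y -> y <= x by move=> ->.
have [r|r|r] := germ_trichotomy 1 ga; have [l|l|l] := germ_trichotomy (-1) ga.
- by case: (germ_min_false r l).
- by apply: up; [exact: germ_weaken lte r|exact: germ_weaken eqge l].
- by apply: up; [exact: germ_weaken lte r|exact: germ_weaken gte l].
- by apply: down; [exact: germ_weaken eqge r|exact: germ_weaken lte l].
- by apply: up; [exact: germ_weaken eqle r|exact: germ_weaken eqge l].
- by apply: up; [exact: germ_weaken eqle r|exact: germ_weaken gte l].
- by apply: down; [exact: germ_weaken gte r|exact: germ_weaken lte l].
- by apply: down; [exact: germ_weaken gte r|exact: germ_weaken eqle l].
- exfalso; apply: (@germ_min_false (\- a)).
    by apply: germ_weaken (germ_opp r) => x y; rewrite ltrN2.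
  by apply: germ_weaken (germ_opp l) => x y; rewrite ltrN2.
Qed.

End Monotonicity.

(** * Definable selection of minimizers *)

Section Selection.
Context {R : realType} {n : nat}.
Implicit Types (P : R -> 'cV[R]_n -> Prop) (N : 'cV[R]_n -> R) (e : seq R).

Definition block off e : 'cV[R]_n := \col_(i < n) e`_(off + i).

(** The block lies above variable [i], so quantifying over it leaves that variable untouched. *)
Definition definable_rel P :=
  forall i off, (i < off)%N -> definable (fun e => P e`_i (block off e)).

Definition definable_poly N := forall off, definable_term (fun e => N (block off e)).

(** Each layer is a single [set_nth], so that quantifying over [w] amounts to [m] nested real
    quantifiers. *)
Fixpoint update off m (w : nat -> R) e : seq R :=
  if m is m'.+1 then update off m' w (set_nth 0 e (off + m') (w m')) else e.

Lemma nth_update off m w e j :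
  (update off m w e)`_j = if (off <= j < off + m)%N then w (j - off)%N else e`_j.
Proof.
elim: m e => [|m IHm] e /=; first by rewrite addn0 ltnNge andbN.
rewrite IHm nth_set_nth/= addnS ltnS.
have [->|nj] := eqVneq j (off + m)%N; first by rewrite ltnn leqnn leq_addr addKn.
by rewrite (leq_eqVlt j) (negbTE nj).
Qed.

Lemma definable_all_update off m (P : seq R -> Prop) : definable P ->
  definable (fun e => forall w, P (update off m w e)).
Proof.
move=> dP; elim: m => [|m IHm].
  by apply: definable_ext dP => e; split=> [//|/(_ (fun=> 0))].
apply: definable_ext (definable_all (off + m) IHm) => e; split=> [h w|h x w] /=.
  exact: h.
pose w' j := if j == m then x else w j.
apply: (definable_same_env dP) (h w') => j.
rewrite /= /w' eqxx !nth_update; case: ifP => // /andP[le1 le2].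
by rewrite ltn_eqF// ltn_subLR.
Qed.

(** The side condition says that [P] sees the block only through its vector argument; overwriting
    the block then runs through all vectors. *)
Lemma definable_all_block off (P : seq R -> 'cV[R]_n -> Prop) :
  (forall e w y, P (update off n w e) y <-> P e y) ->
  definable (fun e => P e (block off e)) -> definable (fun e => forall y, P e y).
Proof.
move=> Pupd /(definable_all_update off n); apply: definable_ext => e.
have blockE w : block off (update off n w e) = \col_(j < n) w j.
  by apply/colP => j; rewrite !mxE nth_update leq_addr ltn_add2l ltn_ord addKn.
split=> [h y|h w]; last exact/Pupd.
pose w j := oapp (fun j' => y j' 0) 0 (insub j : option 'I_n).
have /Pupd := h w; rewrite blockE; congr (P _ _).
by apply/colP => j; rewrite mxE /w valK.
Qed.

Lemma nth_update_lt off w e i : (i < off)%N -> (update off n w e)`_i = e`_i.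
Proof. by move=> ioff; rewrite nth_update leqNgt ioff. Qed.

Lemma block_update off0 off w e : (off0 + n <= off)%N ->
  block off0 (update off n w e) = block off0 e.
Proof.
move=> le_off; apply/colP => j; rewrite !mxE nth_update_lt//.
by rewrite (leq_trans _ le_off)// ltn_add2l.
Qed.

Lemma definable_inhabited P i : definable_rel P ->
  definable (fun e => exists x, P e`_i x).
Proof.
move=> dP.
have /definable_not : definable (fun e => forall x, ~ P e`_i x).
  apply: (@definable_all_block i.+1 (fun e x => ~ P e`_i x)).
    by move=> e w x; rewrite nth_update_lt.
  by apply: definable_not; exact: dP.
by apply: definable_ext => e; rewrite -existsNP; split=> -[x]; [move/contrapT|];
  exists x => //; exact.
Qed.

Definition argmin_rel P N t x := P t x /\ forall y, P t y -> N x <= N y.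

Lemma definable_argmin P N : definable_rel P -> definable_poly N ->
  definable_rel (argmin_rel P N).
Proof.
move=> dP dN i off ioff; apply: definable_and; first exact: dP.
(* The competitor [y] gets the next block, disjoint from that of the candidate. *)
apply: (@definable_all_block (off + n)
  (fun e y => P e`_i y -> N (block off e) <= N y)).
  by move=> e w y; rewrite block_update// nth_update_lt// ltn_addr.
apply: definable_imp; first by apply: dP; rewrite ltn_addr.
exact: definable_le.
Qed.

Fixpoint lex_argmin P (Ns : seq ('cV[R]_n -> R)) :=
  if Ns is N :: Ns' then lex_argmin (argmin_rel P N) Ns' else P.

Lemma definable_lex_argmin P Ns : definable_rel P ->
  (forall N, List.In N Ns -> definable_poly N) -> definable_rel (lex_argmin P Ns).
Proof.
elim: Ns P => //= N Ns IHNs P dP dN; apply: IHNs; last by move=> M ?; apply: dN; right.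
by apply: definable_argmin => //; apply: dN; left.
Qed.

Lemma lex_argminW P Ns t x : lex_argmin P Ns t x -> P t x.
Proof. by elim: Ns P => //= N Ns IHNs P /IHNs[]. Qed.

Lemma lex_argmin_eq P Ns t x y N : List.In N Ns ->
  lex_argmin P Ns t x -> lex_argmin P Ns t y -> N x = N y.
Proof.
elim: Ns P => //= M Ns IHNs P [->|]; last exact: IHNs.
move=> /lex_argminW[Px minx] /lex_argminW[Py miny].
by apply/eqP; rewrite eq_le minx// miny.
Qed.

(** Compactness of the set of minimizers is returned too, so that the next function can be minimized
    over it. *)
Lemma argmin_rel_compact P N t : continuous N -> compact [set x | P t x] ->
  (exists x, P t x) ->
  compact [set x | argmin_rel P N t x] /\ exists x, argmin_rel P N t x.
Proof.
move=> cN cP P0.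
have [|x Px minx] := @compact_EVT_min _ _ N _ P0 cP; first exact: continuous_subspaceT.
rewrite inE/= in Px.
have argx : argmin_rel P N t x by split=> // y Py; apply: minx; rewrite inE.
split; last by exists x.
rewrite (_ : [set _ | _] = [set z | P t z] `&` N @^-1` [set r | r <= N x]); last first.
  apply/seteqP; split=> z [Pz minz]; split=> //; first exact: minz.
  by move=> y Py; apply: (le_trans minz); apply: minx; rewrite inE.
apply: compact_closedI => //; apply: closed_comp; last exact: closed_le.
by move=> z _; exact: cN.
Qed.

Lemma lex_argmin_exists P Ns t : (forall N, List.In N Ns -> continuous N) ->
  compact [set x | P t x] -> (exists x, P t x) -> exists x, lex_argmin P Ns t x.
Proof.
elim: Ns P => //= N Ns IHNs P cN cP P0.
have [c1 e1] := argmin_rel_compact (cN _ (or_introl erefl)) cP P0.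
by apply: IHNs => // M ?; apply: cN; right.
Qed.

Lemma definable_coord (i : 'I_n) : definable_poly (fun x => x i 0).
Proof.
move=> off; have [t tP] := term_var (R := R) (off + i).
by exists t => e; rewrite tP mxE.
Qed.

(** The value 0 where the relation has no solution makes the graph expressible by two implications,
    one for each case. *)
Lemma definable_rel_graph P (f : R -> 'cV[R]_n) N : definable_rel P ->
  (forall t x, P t x -> x = f t) ->
  (forall t, ~ (exists x, P t x) -> f t = 0) ->
  definable_poly N -> definable_graph (N \o f).
Proof.
move=> dP fP f0 dN i j ij.
pose off := (maxn i j).+1.
have ioff : (i < off)%N by rewrite ltnS leq_maxl.
have joff : (j < off)%N by rewrite ltnS leq_maxr.
have d1 : definable (fun e => forall x, P e`_i x -> N x = e`_j).
  apply: (@definable_all_block off (fun e x => P e`_i x -> N x = e`_j)).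
    by move=> e w x; rewrite !nth_update_lt.
  by apply: definable_imp; [exact: dP|apply: definable_eq; [exact: dN|exact: term_var]].
have d2 := definable_not (definable_inhabited i dP).
have d3 : definable (fun e : seq R => e`_j = N 0).
  by apply: definable_eq; [exact: term_var|exact: term_const].
apply: definable_ext (definable_and d1 (definable_imp d2 d3)) => e /=; split.
  move=> [h1 h2]; have [[x Px]|nP] := pselect (exists x, P e`_i x).
    by rewrite -(h1 _ Px) (fP _ _ Px).
  by rewrite f0// h2.
by move=> h; split=> [x /fP -> //|nP]; rewrite h f0.
Qed.

(* Breaking ties by minimizing the coordinates one after the other makes the
   minimizer unique, hence definable without any choice. *)
Lemma definable_argmin_selection P N : definable_rel P -> definable_poly N ->
  continuous N -> (forall t, compact [set x | P t x]) ->
  exists f : R -> 'cV[R]_n,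
    [/\ forall t, (exists x, P t x) -> argmin_rel P N t (f t),
        definable_graph (N \o f)
      & forall i : 'I_n, definable_graph (fun t => f t i 0)].
Proof.
move=> dP dN cN cP.
pose Ns := N :: [seq (fun x : 'cV[R]_n => x i 0) | i <- enum 'I_n].
have InNs M : List.In M Ns -> M = N \/ exists i : 'I_n, M = fun x => x i 0.
  move=> /= [->|]; first by left.
  by elim: (enum _) => //= i s IHs [<-|/IHs//]; right; exists i.
have coordNs i : List.In (fun x : 'cV[R]_n => x i 0) Ns.
  right; have : i \in enum 'I_n by rewrite mem_enum.
  elim: (enum _) => //= j s IHs; rewrite in_cons => /orP[/eqP ->|/IHs]; by [left|right].
pose Q := lex_argmin P Ns.
have dQ : definable_rel Q.
  apply: definable_lex_argmin => // M /InNs[->//|[i ->]]; exact: definable_coord.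
have Quniq t x y : Q t x -> Q t y -> x = y.
  by move=> Qx Qy; apply/colP => i; exact: (lex_argmin_eq (coordNs i) Qx Qy).
pose f t : 'cV[R]_n := xget 0 [set x | Q t x].
have Qf t x : Q t x -> Q t (f t) by move=> Qx; exact: (@xgetI _ _ [set x | Q t x] x).
have ff t x : Q t x -> x = f t by move=> Qx; exact: Quniq Qx (Qf _ _ Qx).
have f0 t : ~ (exists x, Q t x) -> f t = 0.
  by move=> nQ; rewrite /f; case: xgetP => // x _ Qx; case: nQ; exists x.
exists f; split.
- move=> t Pt; have [|//|x Qx] := @lex_argmin_exists P Ns t _ (cP t).
    by move=> M /InNs[->//|[i ->]]; exact: coord_continuous.
  exact: (@lex_argminW (argmin_rel P N) _ _ _ (Qf _ _ Qx)).
- exact: (definable_rel_graph dQ ff f0 dN).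
- move=> i; exact: (definable_rel_graph dQ ff f0 (definable_coord i)).
Qed.

End Selection.

(** * The Kurdyka-Lojasiewicz inequality *)

Section KurdykaLojasiewicz.
Context {R : realType}.

(** The quadratic term is absorbed: if [D <= h] then [D ^+ 2 <= h * D]; otherwise
    [d <= 2 * C * h ^+ 2 <= 2 * C * h * D]. *)
Lemma increment_bound (C h d D : R) : 0 < C -> 0 < h -> 0 <= D ->
  d <= 2 * C * h ^+ 2 -> d <= C * (h * D + D ^+ 2) -> d <= 2 * C * h * D.
Proof.
move=> C0 h0 D0 dh dD; have [Dh|hD] := leP D h.
  apply: (le_trans dD); rewrite -!mulrA (mulrCA 2) ler_pM2l// expr2.
  have : D * D <= h * D by rewrite ler_wpM2r.
  lra.
apply: (le_trans dh); rewrite expr2 mulrA ler_wpM2l ?ltW// mulr_gt0// mulr_gt0//.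
Qed.

Lemma subdivision_bound (V : R -> R) (C h s t : R) : 0 < C -> 0 < h -> s < t ->
  (forall u v, s <= u -> u < v -> v <= t ->
     V u <= V v /\ v - u <= C * (h * (V v - V u) + (V v - V u) ^+ 2)) ->
  t - s <= 2 * C * h * (V t - V s).
Proof.
move=> C0 h0 st Vh.
(* This number of pieces makes the mesh at most [2 * C * h ^+ 2], as [increment_bound] requires; the
   increments of [V] then telescope. *)
pose m := (Num.trunc ((t - s) / (2 * C * h ^+ 2))).+1.
have m0 : (0 : R) < m%:R by rewrite ltr0n.
pose d := (t - s) / m%:R.
have d0 : 0 < d by rewrite divr_gt0// subr_gt0.
have dh : d <= 2 * C * h ^+ 2.
  have k0 : 0 < 2 * C * h ^+ 2 by rewrite !mulr_gt0// exprn_gt0.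
  by rewrite ler_pdivrMr// mulrC -ler_pdivrMr// ltW// truncnS_gt.
have dm : d * m%:R = t - s by rewrite divfK// gt_eqF.
suff step j : (j <= m)%N -> d * j%:R <= 2 * C * h * (V (s + d * j%:R) - V s).
  by have := step m (leqnn _); rewrite dm subrKC.
elim: j => [|j IHj] jm; first by rewrite mulr0 addr0 subrr mulr0.
have dj1 : d * j.+1%:R = d * j%:R + d by rewrite -natr1 mulrDr mulr1.
have j0 : 0 <= d * j%:R by rewrite mulr_ge0// ltW.
have jt : s + d * j.+1%:R <= t by rewrite -lerBrDl -dm ler_pM2l// ler_nat.
rewrite dj1 addrA in jt *.
have [||//|V1 V2] := Vh (s + d * j%:R) (s + d * j%:R + d); [lra|lra|].
have D0 : 0 <= V (s + d * j%:R + d) - V (s + d * j%:R) by rewrite subr_ge0.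
have {V2}: d <= 2 * C * h * (V (s + d * j%:R + d) - V (s + d * j%:R)).
  by apply: increment_bound => //; move: V2; rewrite [X in X <= _]addrC addKr.
have := IHj (ltnW jm); rewrite !mulrBr; lra.
Qed.

(** If [h = 0], the estimate holds with every [e > 0] in place of [h], and a small [e] contradicts
    [s < t]. This is how the gradient is shown not to vanish on levels near 0+. *)
Lemma subdivision_bound0 (V : R -> R) (C h s t : R) : 0 < C -> 0 <= h -> s < t ->
  (forall u v, s <= u -> u < v -> v <= t ->
     V u <= V v /\ v - u <= C * (h * (V v - V u) + (V v - V u) ^+ 2)) ->
  0 < h /\ t - s <= 2 * C * h * (V t - V s).
Proof.
move=> C0; rewrite le_eqVlt => /predU1P[<-|h0] st Vh; last first.
  by split=> //; exact: subdivision_bound.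
have [Vst _] := Vh s t (lexx _) st (lexx _).
have bound e : 0 < e -> t - s <= 2 * C * e * (V t - V s).
  move=> e0; apply: subdivision_bound => // u v su uv vt.
  have [Vuv dV] := Vh u v su uv vt; split=> //; apply: (le_trans dV).
  by rewrite ler_pM2l// lerD2r mul0r mulr_ge0 ?subr_ge0// ltW.
(* The summand 1 makes [k] positive; for [e = (t - s) / k] the bound equals [(t - s) - (t - s) / k],
   which is too small. *)
pose k := 2 * C * (V t - V s) + 1.
have k0 : 0 < k by rewrite ltr_wpDl// mulr_ge0 ?subr_ge0// mulr_ge0// ltW.
have e0 : 0 < (t - s) / k by rewrite divr_gt0// subr_gt0.
have := bound _ e0.
rewrite (_ : _ * _ * _ * _ = (t - s) / k * (k - 1)); last by rewrite /k; ring.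
rewrite mulrBr mulr1 divfK ?gt_eqF//; lra.
Qed.

Variable n : nat.

Definition l1norm (x : 'cV[R]_n) : R := \sum_i `|x i 0|.

(** With one sign per coordinate, the 1-norm of an increment is exactly an increment of the signed
    sum. This additivity is what the 1-norm offers over the Euclidean norm. *)
Lemma bounded_monotone_total (f : R -> 'cV[R]_n) :
  (forall i, monotone_near0 (fun t => f t i 0)) -> exists (V : R -> R) (eps : R),
    [/\ 0 < eps, forall t, `|V t| <= l1norm (f t)
      & forall u v, 0 < u -> u <= v -> v < eps -> V v - V u = l1norm (f v - f u)].
Proof.
move=> fmono.
have {fmono} sgn i : exists p : R * bool, 0 < p.1 /\
    forall u v, 0 < u -> u <= v -> v < p.1 ->
      (-1) ^+ p.2 * (f v i 0 - f u i 0) = `|f v i 0 - f u i 0|.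
  have [e e0 [up|down]] := fmono i.
    exists (e, false); split=> // u v u0 uv ve.
    by rewrite expr0 mul1r ger0_norm// subr_ge0 up.
  exists (e, true); split=> // u v u0 uv ve.
  by rewrite expr1 mulN1r ler0_norm// subr_le0 down.
have [p pP] := choice sgn.
exists (fun t => \sum_i (-1) ^+ (p i).2 * f t i 0), (\big[Num.min/1]_i (p i).1); split.
- by apply: lt_bigmin => // i _; case: (pP i).
- move=> t; apply: (le_trans (ler_norm_sum _ _ _)); apply: ler_sum => i _.
  by rewrite normrM normrX normrN1 expr1n mul1r.
- move=> u v u0 uv ve; rewrite -sumrB; apply: eq_bigr => i _.
  rewrite -mulrBr !mxE; case: (pP i) => _ ->//.
  by rewrite (lt_le_trans ve)// bigmin_le_cond.
Qed.

(** [N] plays the squared norm of the gradient, taken at the endpoint [y] in the expansion.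
    Comparing [x] with the minimizer of [N] on its level reduces the claim to the selection. *)
Theorem definable_KL (S : set 'cV[R]_n) (F N : 'cV[R]_n -> R) (fs C b : R) :
  definable_rel (fun t x => S x /\ F x = fs + t) ->
  (forall t, compact [set x | S x /\ F x = fs + t]) ->
  definable_poly N -> continuous N ->
  0 < C ->
  (forall x y, S x -> S y ->
     F y - F x <= C * (Num.sqrt (N y) * l1norm (y - x) + l1norm (y - x) ^+ 2)) ->
  (forall x, S x -> l1norm x <= b) ->
  exists (eps M : R) (psi : R -> R), [/\ 0 < eps,
    forall t, 0 < t < eps -> `|psi t| <= M
    & forall s t x, 0 < s -> s < t -> t < eps -> S x -> F x = fs + t ->
        0 < Num.sqrt (N x) /\ t - s <= Num.sqrt (N x) * (psi t - psi s)].
Proof.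
move=> dP cP dN cN C0 FN Sb.
have dE := definable_inhabited (n := n) 0 dP.
(* Either all levels just above [fs] are empty, and the conclusion is vacuous, or all are
   inhabited. *)
have [/near0P[e0 e00 ne]|/near0P[e0 e00 em]] := definable_decided [::] dE; last first.
  exists e0, 0, (fun=> 0); split=> // [t _|s t x s0 st te Sx Fx]; first by rewrite normr0.
  exfalso; apply: (em t); first by rewrite te (lt_trans s0).
  by exists x.
have [f [fP gN gi]] := definable_argmin_selection dP dN cN cP.
have {ne} fP t : 0 < t < e0 -> [/\ S (f t), F (f t) = fs + t
    & forall x, S x -> F x = fs + t -> Num.sqrt (N (f t)) <= Num.sqrt (N x)].
  move=> /ne /fP[[Sf Ff] minf]; split=> // x Sx Fx.
  by apply: ler_wsqrtr; apply: minf.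
have [V [e1 [e10 Vb Vf]]] := bounded_monotone_total (fun i => definable_monotone (gi i)).
have [e2 e20 mono] := definable_monotone gN.
pose e := Num.min e0 (Num.min e1 e2).
have e_gt0 : 0 < e by rewrite !lt_min e00 e10.
have ee0 t : t < e -> [/\ t < e0, t < e1 & t < e2].
  by rewrite !lt_min => /and3P[].
pose h t := Num.sqrt (N (f t)).
have slope s t H : 0 < s -> s < t -> t < e -> 0 <= H ->
    (forall v, s <= v -> v <= t -> h v <= H) -> 0 < H /\ t - s <= 2 * C * H * (V t - V s).
  move=> s0 st te H0 hH; apply: subdivision_bound0 => // u v su uv vt.
  have u0 : 0 < u by lra.
  have v0 : 0 < v by lra.
  have [ve0 ve1 _] := ee0 _ (le_lt_trans vt te).
  have Vuv := Vf u v u0 (ltW uv) ve1.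
  have D0 : 0 <= V v - V u by rewrite Vuv sumr_ge0.
  split; first by rewrite -subr_ge0.
  have [|Sv Fv _] := fP v; first by rewrite v0.
  have [|Su Fu _] := fP u; first by rewrite u0 (lt_trans uv).
  have := FN _ _ Su Sv; rewrite Fv Fu -Vuv (_ : _ - _ = v - u); last by ring.
  move/le_trans; apply; rewrite ler_pM2l// lerD2r ler_wpM2r// hH//; lra.
have e2_pos : 0 < e / 2 by rewrite divr_gt0.
case: mono => mono.
(* [h] nondecreasing: on [s, t] it is at most [h t], itself at most [Num.sqrt (N x)]. *)
- exists e, (2 * C * b), (fun t => 2 * C * V t); split=> //.
    move=> t /andP[t0 te]; have C2 : 0 < 2 * C by rewrite mulr_gt0.
    rewrite normrM (gtr0_norm C2) ler_pM2l//.
    have [te0 _ _] := ee0 _ te; have [|Sf _ _] := fP t; first by rewrite t0.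
    by rewrite (le_trans (Vb t))// Sb.
  move=> s t x s0 st te Sx Fx; have [te0 te1 te2] := ee0 _ te.
  have [|Sf Ff minf] := fP t; first by rewrite te0 (lt_trans s0).
  have [||H0 HV] := slope s t (Num.sqrt (N x)) s0 st te; first exact: sqrtr_ge0.
    move=> v sv vt; apply: (le_trans _ (minf _ Sx Fx)).
    by apply: ler_wsqrtr; apply: mono => //; lra.
  by split=> //; apply: (le_trans HV); rewrite -mulrBr mulrA (mulrC (Num.sqrt _)).
(* [h] nonincreasing: one use of [slope] to the right of [e / 2] gives [H > 0], and [h] is at least
   [H] on the left, so a linear [psi] suffices. *)
- pose H := h (e / 2).
  have [|||||H0 _] := slope (e / 2) (3 * e / 4) H; try lra.
  + exact: sqrtr_ge0.
  + move=> v ev ve; apply: ler_wsqrtr; apply: mono; try lra.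
    by have [] := ee0 v; lra.
  exists (e / 2), (e / H), (fun t => t / H); split=> //.
    move=> t /andP[t0 te]; rewrite gtr0_norm ?divr_gt0// ler_pM2r ?invr_gt0//; lra.
  move=> s t x s0 st te Sx Fx.
  have [te0 _ _] := ee0 t ltac:(lra).
  have [|Sf Ff minf] := fP t; first by rewrite te0 (lt_trans s0).
  have HN : H <= Num.sqrt (N x).
    apply: (le_trans _ (minf _ Sx Fx)); apply: ler_wsqrtr; apply: mono; try lra.
    by have [] := ee0 (e / 2); lra.
  split; first exact: lt_le_trans HN.
  rewrite -mulrBl mulrA mulrAC -[X in X <= _]mul1r ler_wpM2r ?subr_ge0 ?(ltW st)//.
  by rewrite ler_pdivlMr// mul1r.
Qed.

End KurdykaLojasiewicz.

(** * Finite length of descent sequences *)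

(** Apply [psi] to the excess of [F] over its limit, positive by strict decrease. The factor [h]
    occurs in both the decrease and the inequality and cancels, leaving [c0 * len c] below an
    increment of [psi]; these telescope to at most [2 * M]. *)
Lemma finite_length {R : realType} {T : Type} (S : set T) (F h : T -> R) (x : nat -> T)
    (len : nat -> R) (c0 lb : R) :
  (forall fs, exists (eps M : R) (psi : R -> R), [/\ 0 < eps,
    forall t, 0 < t < eps -> `|psi t| <= M
    & forall s t z, 0 < s -> s < t -> t < eps -> S z -> F z = fs + t ->
        0 < h z /\ t - s <= h z * (psi t - psi s)]) ->
  (forall c, S (x c)) -> (forall c, lb <= F (x c)) ->
  (forall c, F (x c.+1) < F (x c)) -> 0 < c0 -> 
  (forall c, c0 * h (x c) * len c <= F (x c) - F (x c.+1)) ->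
  (forall c, 0 <= len c) ->
  exists A, forall m, \sum_(0 <= c < m) len c <= A.
Proof.
move=> KL xS Flb Fdec c0_gt0 Flen len0.
pose a c := F (x c).
have a_dec : nonincreasing_seq a.
  by apply/nonincreasing_seqP => c; exact/ltW/Fdec.
have a_lb : has_lbound (range a) by exists lb => _ [c _ <-]; exact: Flb.
have a_cvg := nonincreasing_cvgn a_dec a_lb.
pose fs := inf (range a).
have a_fs c : fs < a c.
  by apply: le_lt_trans (Fdec c); apply: ge_inf => //; exists c.+1.
have [eps [M [psi [eps0 psiM KLpsi]]]] := KL fs.
have [c1 c1P] : exists c1, forall c, (c1 <= c)%N -> a c < fs + eps.
  have /cvgrPdist_lt/(_ _ eps0)[c1 _ c1P] := a_cvg.
  exists c1 => c cc1; have := c1P c cc1; rewrite /= distrC ltr_norml -/fs; lra.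
have tail c : (c1 <= c)%N -> c0 * len c <= psi (a c - fs) - psi (a c.+1 - fs).
  move=> cc1; have [|||||h0 hpsi] := KLpsi (a c.+1 - fs) (a c - fs) (x c).
  - by rewrite subr_gt0.
  - by rewrite ltrD2r; exact: Fdec.
  - by rewrite ltrBlDl; exact: c1P.
  - exact: xS.
  - by rewrite subrKC.
  rewrite -(ler_pM2l h0) (le_trans _ hpsi)//.
  apply: le_trans (_ : F (x c) - F (x c.+1) <= _); last by rewrite /a; lra.
  by apply: le_trans (Flen c); rewrite mulrCA mulrA.
have part m : c0 * \sum_(c1 <= c < c1 + m) len c <= psi (a c1 - fs) - psi (a (c1 + m)%N - fs).
  elim: m => [|m IHm]; first by rewrite addn0 big_geq// mulr0 subrr.
  rewrite addnS big_nat_recr/= ?leq_addr// mulrDr.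
  have := tail (c1 + m)%N (leq_addr _ _); lra.
have psib c : (c1 <= c)%N -> `|psi (a c - fs)| <= M.
  move=> cc1; apply: psiM; rewrite subr_gt0 a_fs/= ltrBlDl; exact: c1P.
exists (\sum_(0 <= c < c1) len c + 2 * M / c0) => m.
(* Truncated subtraction empties the second sum when [m <= c1], so one formula covers both cases. *)
have -> : \sum_(0 <= c < m) len c = \sum_(0 <= c < minn m c1) len c
    + \sum_(c1 <= c < c1 + (m - c1)) len c.
  have [mc|/ltnW mc] := leqP m c1.
    by rewrite (eqP mc) addn0 [X in _ + X]big_geq// addr0.
  by rewrite subnKC// -big_cat_nat.
apply: lerD.
  by rewrite (big_cat_nat (leq0n _) (geq_minr m c1))/= lerDl sumr_ge0.
rewrite ler_pdivlMr// mulrC; apply: (le_trans (part _)).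
have := psib c1 (leqnn _); have := psib _ (leq_addr (m - c1) c1).
rewrite !ler_norml; lra.
Qed.

(** * Euclidean inner product and norms *)

Section Euclidean.
Context {R : realType} {n : nat}.
Implicit Types u v w : 'cV[R]_n.

Lemma dotE u v : dot u v = \sum_i u i 0 * v i 0.
Proof. by rewrite /dot !mxE; apply: eq_bigr => i _; rewrite !mxE. Qed.

Lemma dotC u v : dot u v = dot v u.
Proof. by rewrite !dotE; apply: eq_bigr => i _; rewrite mulrC. Qed.

Lemma dotDl u v w : dot (u + v) w = dot u w + dot v w.
Proof. by rewrite !dotE -big_split; apply: eq_bigr => i _; rewrite !mxE mulrDl. Qed.

Lemma dotZl a u w : dot (a *: u) w = a * dot u w.
Proof. by rewrite !dotE mulr_sumr; apply: eq_bigr => i _; rewrite !mxE mulrA. Qed.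

Lemma dotDr u v w : dot w (u + v) = dot w u + dot w v.
Proof. by rewrite dotC dotDl !(dotC w). Qed.

Lemma dotZr a u w : dot w (a *: u) = a * dot w u.
Proof. by rewrite dotC dotZl (dotC w). Qed.

Lemma dotNl u w : dot (- u) w = - dot u w.
Proof. by rewrite -scaleN1r dotZl mulN1r. Qed.

Lemma dotNr u w : dot w (- u) = - dot w u.
Proof. by rewrite dotC dotNl dotC. Qed.

Lemma dot0r u : dot u 0 = 0.
Proof. by rewrite dotE big1// => i _; rewrite mxE mulr0. Qed.

Lemma dot_ge0 u : 0 <= dot u u.
Proof. by rewrite dotE sumr_ge0// => i _; rewrite -expr2 sqr_ge0. Qed.

Lemma dot_eq0 u : dot u u = 0 -> u = 0.
Proof.
rewrite dotE => /psumr_eq0P u0; apply/colP => i; rewrite mxE.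
by apply/eqP; rewrite -sqrf_eq0 expr2 u0// => j _; rewrite -expr2 sqr_ge0.
Qed.

Lemma dot_mulmxr u (A : 'M[R]_n) v : dot u (A *m v) = dot (A^T *m u) v.
Proof. by rewrite /dot trmx_mul trmxK mulmxA. Qed.

Lemma enorm_ge0 u : 0 <= enorm u.
Proof. exact: sqrtr_ge0. Qed.

Lemma sqr_enorm u : enorm u ^+ 2 = dot u u.
Proof. by rewrite sqr_sqrtr// dot_ge0. Qed.

Lemma enorm_eq0 u : enorm u = 0 -> u = 0.
Proof. by move=> u0; apply: dot_eq0; rewrite -sqr_enorm u0 expr0n. Qed.

Lemma enorm0 : enorm (0 : 'cV[R]_n) = 0.
Proof. by rewrite /enorm dot0r sqrtr0. Qed.

Lemma enormZ a u : enorm (a *: u) = `|a| * enorm u.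
Proof. by rewrite /enorm dotZl dotZr mulrA -expr2 sqrtrM ?sqr_ge0// sqrtr_sqr. Qed.

Lemma enormN u : enorm (- u) = enorm u.
Proof. by rewrite -scaleN1r enormZ normrN1 mul1r. Qed.

Lemma enorm_le u b : 0 <= b -> dot u u <= b ^+ 2 -> enorm u <= b.
Proof. by move=> b0 /ler_wsqrtr; rewrite sqrtr_sqr ger0_norm. Qed.

Lemma cauchy_schwarz u v : `|dot u v| <= enorm u * enorm v.
Proof.
suff : dot u v ^+ 2 <= dot u u * dot v v.
  by move=> /ler_wsqrtr; rewrite sqrtr_sqr sqrtrM ?dot_ge0.
have := dot_ge0 (dot v v *: u - dot u v *: v).
rewrite !(dotDl, dotDr, dotNl, dotNr, dotZl, dotZr) (dotC v u).
have [/eqP|v0] := eqVneq (dot v v) 0.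
  by move=> /eqP/dot_eq0 -> _; rewrite !dot0r expr0n/= mulr0.
have {v0} : 0 < dot v v by rewrite lt_neqAle eq_sym v0 dot_ge0.
move: (dot v v) (dot u u) (dot u v) => a b c a0 h.
rewrite -(ler_pM2l a0); lra.
Qed.

Lemma enormD u v : enorm (u + v) <= enorm u + enorm v.
Proof.
apply: enorm_le; first by rewrite addr_ge0// enorm_ge0.
rewrite !(dotDl, dotDr) sqrrD !sqr_enorm (dotC v u).
have := le_trans (ler_norm _) (cauchy_schwarz u v); lra.
Qed.

Lemma coord_le_enorm u i : `|u i 0| <= enorm u.
Proof.
rewrite -sqrtr_sqr; apply: ler_wsqrtr; rewrite dotE (bigD1 i)//= expr2 lerDl.
by rewrite sumr_ge0// => j _; rewrite -expr2 sqr_ge0.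
Qed.

Lemma l1norm_ge0 u : 0 <= l1norm u.
Proof. exact: sumr_ge0. Qed.

Lemma l1norm_le u : l1norm u <= n%:R * enorm u.
Proof.
rewrite -[n in n%:R]card_ord -sumr_const mulr_suml.
by apply: ler_sum => i _; rewrite mul1r coord_le_enorm.
Qed.

Lemma enorm_le_l1norm u : enorm u <= l1norm u.
Proof.
apply: enorm_le; first exact: l1norm_ge0.
rewrite expr2 {1}/l1norm mulr_suml dotE; apply: ler_sum => i _.
rewrite (le_trans (ler_norm _))// normrM ler_wpM2l// /l1norm (bigD1 i)//= lerDl.
exact: sumr_ge0.
Qed.

Lemma l1norm_sphere u : on_sphere u -> l1norm u <= n%:R.
Proof. by move=> u1; rewrite (le_trans (l1norm_le u))// u1 mulr1. Qed.

Lemma coord_sphere u i : on_sphere u -> `|u i 0| <= 1.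
Proof. by move=> <-; exact: coord_le_enorm. Qed.

Lemma on_sphere_neq0 u : on_sphere u -> u != 0.
Proof. by rewrite /on_sphere; apply: contra_eqN => /eqP ->; rewrite enorm0 eq_sym oner_eq0. Qed.

Lemma on_sphereE u : on_sphere u <-> dot u u = 1.
Proof.
split=> u1; first by rewrite -sqr_enorm u1 expr1n.
by rewrite /on_sphere /enorm u1 sqrtr1.
Qed.

End Euclidean.

(** * Symmetric tensors on the sphere *)

Section PolynomialFunctions.
Context {R : realType} {n : nat}.
Implicit Types (N M : 'cV[R]_n -> R).

(** [definable_poly] admits inverses and does not yield continuity; the selection of minimizers
    consumes both properties. *)
Definition polynomial_fun N := definable_poly N /\ continuous N.

Lemma polynomial_coord (i : 'I_n) : polynomial_fun (fun x => x i 0).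
Proof. by split; [exact: definable_coord|exact: coord_continuous]. Qed.

Lemma polynomial_cst c : polynomial_fun (fun=> c).
Proof. by split=> [off|]; [exact: term_const|exact: cst_continuous]. Qed.

Lemma polynomialD N M : polynomial_fun N -> polynomial_fun M ->
  polynomial_fun (fun x => N x + M x).
Proof.
move=> [dN cN] [dM cM]; split=> [off|x]; first exact: term_add.
exact: continuousD (cN x) (cM x).
Qed.

Lemma polynomialM N M : polynomial_fun N -> polynomial_fun M ->
  polynomial_fun (fun x => N x * M x).
Proof.
move=> [dN cN] [dM cM]; split=> [off|x]; first exact: term_mul.
exact: continuousM (cN x) (cM x).
Qed.

Lemma polynomial_sum I (r : seq I) (p : pred I) (N : I -> 'cV[R]_n -> R) :
  (forall i, polynomial_fun (N i)) -> polynomial_fun (fun x => \sum_(i <- r | p i) N i x).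
Proof.
move=> pN; elim: r => [|i r IHr].
  by under eq_fun do rewrite big_nil; exact: polynomial_cst.
under eq_fun do rewrite big_cons.
by case: (p i) => //; exact: polynomialD.
Qed.

Lemma polynomial_prod I (r : seq I) (N : I -> 'cV[R]_n -> R) :
  (forall i, polynomial_fun (N i)) -> polynomial_fun (fun x => \prod_(i <- r) N i x).
Proof.
move=> pN; elim: r => [|i r IHr].
  by under eq_fun do rewrite big_nil; exact: polynomial_cst.
by under eq_fun do rewrite big_cons; exact: polynomialM.
Qed.

Lemma polynomial_dot (f g : 'cV[R]_n -> 'cV[R]_n) :
  (forall i, polynomial_fun (fun x => f x i 0)) ->
  (forall i, polynomial_fun (fun x => g x i 0)) ->
  polynomial_fun (fun x => dot (f x) (g x)).
Proof.
move=> pf pg; under eq_fun do rewrite dotE.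
by apply: polynomial_sum => i; exact: polynomialM.
Qed.

Lemma closed_zeros N : polynomial_fun N -> closed [set x | N x = 0].
Proof.
move=> [_ cN]; rewrite (_ : [set _ | _] = N @^-1` [set r | r = 0])//.
by apply: closed_comp; [move=> x _; exact: cN|exact: closed_eq].
Qed.

Lemma trmx_continuous m p : continuous (@trmx R m p).
Proof.
move=> /= M s /= /(nbhs_ballP (M^T)) [e e0 es].
apply/nbhs_ballP; exists e => //= N [_ MN]; apply: es; split=> // i j.
by rewrite !mxE; exact: MN.
Qed.

Lemma sphere_zeros : [set x : 'cV[R]_n | on_sphere x] = [set x | dot x x - 1 = 0].
Proof.
apply/seteqP; split=> x /=; first by move=> /on_sphereE ->; rewrite subrr.
by move/eqP; rewrite subr_eq0 => /eqP /on_sphereE.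
Qed.

Lemma polynomial_sphere : polynomial_fun (fun x : 'cV[R]_n => dot x x - 1).
Proof.
apply: polynomialD; last exact: polynomial_cst.
by apply: polynomial_dot; exact: polynomial_coord.
Qed.

Lemma compact_sphere : compact [set x : 'cV[R]_n | on_sphere x].
Proof.
pose box := [set v : 'rV[R]_n | forall i, `[-1, 1]%classic (v ord0 i)].
have cbox : compact (trmx @` box).
  apply: continuous_compact; first by apply: continuous_subspaceT; exact: trmx_continuous.
  by apply: (@rV_compact R n (fun=> `[-1, 1]%classic)) => _; exact: segment_compact.
apply: (subclosed_compact _ cbox).
  by rewrite sphere_zeros; exact: (closed_zeros polynomial_sphere).
move=> x x1; exists x^T; last by rewrite trmxK.
by move=> i; rewrite /= in_itv/= mxE -ler_norml coord_sphere.
Qed.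

End PolynomialFunctions.

Section TensorForms.
Context {R : realType} {n : nat}.
Implicit Types (x y h : 'cV[R]_n) (s : seq 'I_n).

Definition monomial s x : R := \prod_(l <- s) x l 0.

(* The derivative of a monomial is the sum of its head derivatives over the
   rotations of the index list, so that the symmetry of a tensor applies as a
   mere reindexing. *)
Definition head_deriv s x h : R := if s is i :: s' then h i 0 * monomial s' x else 0.

Definition monomial_deriv s x h : R := \sum_(0 <= p < size s) head_deriv (rot p s) x h.

Lemma monomial_cons i s x : monomial (i :: s) x = x i 0 * monomial s x.
Proof. by rewrite /monomial big_cons. Qed.

(** The product rule: rotation 0 has [i] at the head, and every later one keeps [i] in its tail,
    where it contributes [x i 0]. *)
Lemma monomial_deriv_cons i s x h :
  monomial_deriv (i :: s) x h = h i 0 * monomial s x + x i 0 * monomial_deriv s x h.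
Proof.
rewrite /monomial_deriv [size (_ :: _)]/= big_nat_recl// rot0 mulr_sumr; congr (_ + _).
apply: eq_big_nat => p /andP[_ ps].
rewrite /rot /= (drop_nth i ps)/= /monomial !big_cat/= big_cons.
by ring.
Qed.

Lemma monomial_le1 s x : (forall i, `|x i 0| <= 1) -> `|monomial s x| <= 1.
Proof.
move=> x1; elim: s => [|i s IHs]; first by rewrite /monomial big_nil normr1.
by rewrite monomial_cons normrM mulr_ile1.
Qed.

Lemma monomial_deriv_le s x h D : (forall i, `|x i 0| <= 1) ->
  (forall i, `|h i 0| <= D) -> `|monomial_deriv s x h| <= (size s)%:R * D.
Proof.
move=> x1 hD; elim: s => [|i s IHs]; first by rewrite /monomial_deriv big_nil normr0 mul0r.
rewrite monomial_deriv_cons (le_trans (ler_normD _ _))//= -natr1 mulrDl mul1r addrC.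
rewrite !normrM lerD//.
  by rewrite -[leRHS]mul1r ler_pM.
by rewrite -[leRHS]mulr1 ler_pM// monomial_le1.
Qed.

(** The remainder for [i :: s] is [y i 0] times that for [s] plus a product of two first-order
    terms; with [m] the size of [s], [m ^+ 2 + m <= (m + 1) ^+ 2] closes the induction. *)
Lemma monomial_taylor s x y D : (forall i, `|x i 0| <= 1) -> (forall i, `|y i 0| <= 1) ->
  (forall i, `|(y - x) i 0| <= D) -> 
  `|monomial s y - monomial s x - monomial_deriv s x (y - x)| <= (size s)%:R ^+ 2 * D ^+ 2.
Proof.
move=> x1 y1 hD; elim: s => [|i s IHs].
  by rewrite /monomial_deriv /monomial !big_nil subrr subr0 normr0 expr0n mul0r.
have D0 : 0 <= D by apply: le_trans (hD i).
rewrite !monomial_cons monomial_deriv_cons.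
rewrite (_ : _ - _ = y i 0 * (monomial s y - monomial s x - monomial_deriv s x (y - x))
    + (y - x) i 0 * monomial_deriv s x (y - x)); last by rewrite !mxE; ring.
have h1 : `|y i 0 * (monomial s y - monomial s x - monomial_deriv s x (y - x))| <=
    (size s)%:R ^+ 2 * D ^+ 2 by rewrite normrM -[leRHS]mul1r ler_pM.
have h2 : `|(y - x) i 0 * monomial_deriv s x (y - x)| <= D * ((size s)%:R * D).
  by rewrite normrM ler_pM// monomial_deriv_le.
rewrite (le_trans (ler_normD _ _))// (le_trans (lerD h1 h2))//= -natr1.
rewrite (_ : D * _ = (size s)%:R * D ^+ 2); last by ring.
rewrite -mulrDl ler_wpM2r ?sqr_ge0//.
have : (0 : R) <= (size s)%:R by []; nra.
Qed.

Context {k : nat}.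
Implicit Types (T B : tensor R k n).

Definition tensor_sum T : R := \sum_j `|T j|.

Lemma tensor_sum_ge0 T : 0 <= tensor_sum T.
Proof. exact: sumr_ge0. Qed.

Lemma dot_tgrad T x h : dot (tgrad T x) h = \sum_j T j * head_deriv (tval j) x h.
Proof.
rewrite dotE.
under eq_bigr do rewrite mxE big_mkcond mulr_suml.
rewrite exchange_big; apply: eq_bigr => j _ /=.
case: (tval j) => [|i s] /=; first by rewrite big1 ?mulr0// => i _; rewrite mul0r.
rewrite (bigD1 i)//= eqxx [X in _ + X]big1; last first.
  by move=> l li; case: eqP => [[il]|]; [rewrite il eqxx in li|rewrite mul0r].
by rewrite addr0 /monomial; ring.
Qed.

(** Euler's identity, without a factor [k] because [tgrad] is the gradient of a symmetric form
    divided by [k]. *)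
Lemma euler_tgrad T x : (0 < k)%N -> dot (tgrad T x) x = tform T x.
Proof.
move=> k0; rewrite dot_tgrad; apply: eq_bigr => j _; congr (_ * _).
case: (tval j) (size_tuple j) => [|i s] /= sk; last by rewrite big_cons.
by rewrite -sk in k0.
Qed.

Lemma sum_monomial_deriv T x h : tensor_sym T ->
  \sum_j T j * monomial_deriv (tval j) x h = k%:R * dot (tgrad T x) h.
Proof.
move=> symT; rewrite dot_tgrad /monomial_deriv.
under eq_bigr do rewrite size_tuple mulr_sumr.
rewrite exchange_big/= (eq_bigr (fun=> \sum_j T j * head_deriv (tval j) x h)).
  by rewrite sumr_const_nat subn0 mulr_natl.
move=> p _; rewrite [RHS](reindex_inj (h := fun j : k.-tuple 'I_n => rot_tuple p j)).
  by apply: eq_bigr => j _; rewrite (symT j [tuple of rot p j])// perm_sym perm_rot.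
by move=> i j /(congr1 val)/rot_inj/val_inj.
Qed.

Lemma tform_taylor T x y D : tensor_sym T ->
  (forall i, `|x i 0| <= 1) -> (forall i, `|y i 0| <= 1) ->
  (forall i, `|(y - x) i 0| <= D) ->
  `|tform T y - tform T x - k%:R * dot (tgrad T x) (y - x)|
    <= k%:R ^+ 2 * tensor_sum T * D ^+ 2.
Proof.
move=> symT x1 y1 hD; rewrite -sum_monomial_deriv// -!sumrB.
rewrite (mulrC (_ ^+ 2)) -mulrA mulr_suml (le_trans (ler_norm_sum _ _ _))//.
apply: ler_sum => j _; rewrite -!mulrBr normrM ler_wpM2l//.
have := monomial_taylor (tval j) x1 y1 hD; rewrite size_tuple; exact.
Qed.

Lemma tform_le T x : (forall i, `|x i 0| <= 1) -> `|tform T x| <= tensor_sum T.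
Proof.
move=> x1; rewrite (le_trans (ler_norm_sum _ _ _))//; apply: ler_sum => j _.
by rewrite normrM ler_piMr// monomial_le1.
Qed.

Lemma tgrad_le T x : (forall i, `|x i 0| <= 1) -> enorm (tgrad T x) <= n%:R * tensor_sum T.
Proof.
move=> x1; rewrite (le_trans (enorm_le_l1norm _))// /l1norm.
rewrite -[n in n%:R]card_ord -sumr_const mulr_suml; apply: ler_sum => i _; rewrite mul1r mxE.
rewrite (le_trans (ler_norm_sum _ _ _))// big_mkcond; apply: ler_sum => j _.
by case: ifP => // _; rewrite normrM ler_piMr// monomial_le1.
Qed.

Lemma polynomial_tform T : polynomial_fun (tform T).
Proof.
apply: polynomial_sum => j; apply: polynomialM; first exact: polynomial_cst.
by apply: polynomial_prod => i; exact: polynomial_coord.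
Qed.

Lemma polynomial_tgrad T i : polynomial_fun (fun x => tgrad T x i 0).
Proof.
under eq_fun do rewrite mxE.
apply: polynomial_sum => j; apply: polynomialM; first exact: polynomial_cst.
by apply: polynomial_prod => l; exact: polynomial_coord.
Qed.

Lemma posdef_sphere B : tensor_posdef B ->
  exists2 b, 0 < b & forall x, on_sphere x -> b <= tform B x.
Proof.
(* In dimension 0 the sphere is empty and any bound does. *)
move=> Bpos; have [[x0 x01]|nS] := pselect (exists x : 'cV[R]_n, on_sphere x); last first.
  by exists 1 => // x x1; case: nS; exists x.
have [|x] := @compact_EVT_min _ _ (tform B) _ (ex_intro _ x0 x01) compact_sphere.
  by apply: continuous_subspaceT; have [] := polynomial_tform B.
rewrite inE/= => x1 minx; exists (tform B x); first exact/Bpos/on_sphere_neq0.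
by move=> y y1; apply: minx; rewrite inE.
Qed.

End TensorForms.

(** * The tensor quotient *)

Section HypergraphTensors.
Context {R : realType} {k n : nat}.

Lemma diag_tensor_sym (d : 'I_n -> R) : tensor_sym (@diag_tensor R k n d).
Proof.
move=> s t; rewrite /diag_tensor !ffunE; move: (tval s) (tval t) => {}s {}t st.
have all_head i u v : perm_eq (i :: u) v -> all (pred1 i) u ->
    (if v is l :: v' then (if all (pred1 l) v' then d l else 0) else 0) = d i.
  move=> uv ui; have : all (pred1 i) v by rewrite -(perm_all _ uv)/= eqxx ui.
  case: v uv => [/perm_size//|l v uv] /= /andP[/eqP -> ->] //.
case: s st => [|i s] st.
  by have := perm_size st; case: t {st}.
case: ifP => [si|nsi]; first by rewrite (all_head _ _ _ st).
case: t st => [//|l t] st; case: ifP => // tl.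
have := all_head _ _ _ (etrans (perm_sym _ _) st) tl; rewrite /= nsi => <-.
by [].
Qed.

Lemma adj_tensor_sym (E : {set {set 'I_n}}) : tensor_sym (adj_tensor R k E).
Proof.
move=> s t st; rewrite /adj_tensor !ffunE.
by rewrite (_ : [set i in s]%SET = [set i in t]%SET)//; apply/setP => i; rewrite !inE (perm_mem st).
Qed.

Lemma hypergraph_tensor_sym (E : {set {set 'I_n}}) (T : tensor R k n) :
  [\/ T = adj_tensor R k E, T = lap_tensor R k E | T = slap_tensor R k E] ->
  tensor_sym T.
Proof.
have degs := @diag_tensor_sym (fun i => (hdegree E i)%:R).
have adjs := @adj_tensor_sym E.
have addE (A A' : tensor R k n) j : (A + A') j = A j + A' j by rewrite ffunE.
have oppE (A : tensor R k n) j : (- A) j = - A j by rewrite ffunE.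
case=> ->; [exact: adjs| |]; move=> s t st; rewrite !addE ?oppE;
  by rewrite (degs s t st) (adjs s t st).
Qed.

End HypergraphTensors.

Section Quotient.
Context {R : realType} {k n : nat} (T B : tensor R k n).
Hypotheses (k_gt0 : (0 < k)%N) (symT : tensor_sym T) (symB : tensor_sym B)
  (posB : tensor_posdef B).
Implicit Types x y : 'cV[R]_n.

Local Notation f := (quot T B).
Local Notation g := (quot_grad T B).

(** Points of the sphere are at distance at most 2, so [D ^+ 2 <= 2 * D] turns the Taylor estimate
    into a Lipschitz one. *)
Lemma tform_lipschitz (A : tensor R k n) : tensor_sym A ->
  exists2 L, 0 < L & forall x y, on_sphere x -> on_sphere y ->
    `|tform A y - tform A x| <= L * enorm (y - x).
Proof.
move=> symA; pose s := tensor_sum A.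
have s0 : 0 <= s by exact: tensor_sum_ge0.
exists (k%:R * (n%:R * s) + k%:R ^+ 2 * s * 2 + 1); first by rewrite ltr_wpDl// addr_ge0// !mulr_ge0.
move=> x y x1 y1; set D := enorm (y - x).
have D0 : 0 <= D by exact: enorm_ge0.
have D2 : D <= 2 by rewrite (le_trans (enormD _ _))// enormN x1 y1.
have c1 i := coord_sphere i x1; have c2 i := coord_sphere i y1.
have := tform_taylor symA c1 c2 (fun i => coord_le_enorm (y - x) i).
rewrite -/D -/s; set d := k%:R * dot _ _ => h1.
have h2 : `|d| <= k%:R * (n%:R * s) * D.
  rewrite normrM normr_nat -mulrA ler_wpM2l//.
  by rewrite (le_trans (cauchy_schwarz _ _))// ler_wpM2r// tgrad_le.
rewrite -(subrK d (_ - _)) (le_trans (ler_normD _ _))// (le_trans (lerD h1 h2))//.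
have : k%:R ^+ 2 * s * D ^+ 2 <= k%:R ^+ 2 * s * (2 * D).
  by rewrite ler_wpM2l ?mulr_ge0// expr2 ler_wpM2r.
lra.
Qed.

Lemma quot_le : exists2 Q, 0 < Q & forall x, on_sphere x -> `|f x| <= Q.
Proof.
have [b b0 bB] := posdef_sphere posB.
exists (tensor_sum T / b + 1); first by rewrite ltr_wpDl// divr_ge0// ?tensor_sum_ge0 ?ltW.
move=> x x1; have Bx : 0 < tform B x by rewrite (lt_le_trans b0)// bB.
rewrite normrM normfV (gtr0_norm Bx) ler_wpDr//.
rewrite ler_pM ?invr_ge0 ?(ltW Bx)//; first by apply: tform_le => i; exact: coord_sphere.
by rewrite lef_pV2 ?posrE// bB.
Qed.

Lemma quot_grad_le : exists2 G, 0 < G & forall x, on_sphere x -> enorm (g x) <= G.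
Proof.
have [b b0 bB] := posdef_sphere posB; have [Q Q0 fQ] := quot_le.
have sT := tensor_sum_ge0 T; have sB := tensor_sum_ge0 B.
exists (k%:R / b * (n%:R * tensor_sum T + Q * (n%:R * tensor_sum B)) + 1).
  by rewrite ltr_wpDl// !(mulr_ge0, addr_ge0)// ?invr_ge0 ltW.
move=> x x1; have Bx : 0 < tform B x by rewrite (lt_le_trans b0)// bB.
have c1 i := coord_sphere i x1.
rewrite enormZ normrM normr_nat normfV (gtr0_norm Bx) ler_wpDr//.
rewrite ler_pM// ?enorm_ge0 ?divr_ge0 ?(ltW Bx)//.
  by rewrite ler_wpM2l// lef_pV2 ?posrE// bB.
rewrite (le_trans (enormD _ _))// enormN enormZ lerD ?tgrad_le//.
by rewrite ler_pM ?enorm_ge0 ?tgrad_le// fQ.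
Qed.

Lemma quot_taylor : exists2 M, 0 < M & forall x y, on_sphere x -> on_sphere y ->
  `|f y - f x - dot (g x) (y - x)| <= M * enorm (y - x) ^+ 2.
Proof.
have [b b0 bB] := posdef_sphere posB; have [Q Q0 fQ] := quot_le.
have [G G0 gG] := quot_grad_le; have [L L0 BL] := tform_lipschitz symB.
pose sT := tensor_sum T; pose sB := tensor_sum B.
have sT0 : 0 <= sT by exact: tensor_sum_ge0.
have sB0 : 0 <= sB by exact: tensor_sum_ge0.
pose M := k%:R ^+ 2 * sT + Q * (k%:R ^+ 2 * sB) + G * L.
have M0 : 0 < M.
  by rewrite ltr_wpDl ?mulr_gt0// addr_ge0// mulr_ge0// ?mulr_ge0// ltW.
exists (M / b); first by rewrite divr_gt0.
move=> x y x1 y1; set D := enorm (y - x).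
have D0 : 0 <= D by exact: enorm_ge0.
have Bx : 0 < tform B x by rewrite (lt_le_trans b0)// bB.
have By : 0 < tform B y by rewrite (lt_le_trans b0)// bB.
have c1 i := coord_sphere i x1; have c2 i := coord_sphere i y1.
have tT := tform_taylor symT c1 c2 (fun i => coord_le_enorm (y - x) i).
have tB := tform_taylor symB c1 c2 (fun i => coord_le_enorm (y - x) i).
rewrite -/D -/sT -/sB in tT tB.
set dT := dot (tgrad T x) (y - x) in tT; set dB := dot (tgrad B x) (y - x) in tB.
have gh : dot (g x) (y - x) = k%:R / tform B x * (dT - f x * dB).
  by rewrite /quot_grad dotZl dotDl dotNl dotZl.
(* Multiplied by [tform B y], the remainder is an exact combination of the Taylor remainders of [T]
   and [B] and of a product of two first-order terms, all of order [D ^+ 2]. *)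
rewrite (_ : f y - f x - dot (g x) (y - x) =
    ((tform T y - tform T x - k%:R * dT) - f x * (tform B y - tform B x - k%:R * dB)
     - dot (g x) (y - x) * (tform B y - tform B x)) / tform B y); last first.
  by rewrite gh /quot; field; rewrite !gt_eqF.
rewrite normrM normfV (gtr0_norm By) [leRHS]mulrAC ler_pM ?invr_ge0 ?(ltW By)//; last first.
  by rewrite lef_pV2 ?posrE// bB.
have b1 : `|f x * (tform B y - tform B x - k%:R * dB)| <= Q * (k%:R ^+ 2 * sB) * D ^+ 2.
  by rewrite normrM -mulrA ler_pM// fQ.
have b2 : `|dot (g x) (y - x) * (tform B y - tform B x)| <= G * L * D ^+ 2.
  rewrite normrM (_ : G * L * D ^+ 2 = (G * D) * (L * D)); last by ring.
  by rewrite ler_pM// ?BL// (le_trans (cauchy_schwarz _ _))// ler_wpM2r// gG.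
rewrite (le_trans (ler_normB _ _))// /M mulrDl lerD//.
by rewrite (le_trans (ler_normB _ _))// mulrDl lerD.
Qed.

(** [f] is homogeneous of degree 0, so its gradient is tangent to the sphere. *)
Lemma quot_grad_euler x : on_sphere x -> dot (g x) x = 0.
Proof.
move=> x1; have Bx : tform B x != 0 by rewrite gt_eqF// posB// on_sphere_neq0.
by rewrite /quot_grad dotZl dotDl dotNl dotZl !euler_tgrad// divfK// subrr mulr0.
Qed.

(** On the sphere, a positive multiple of [g] with factor between fixed constants; being polynomial,
    it is fit for the selection of minimizers. *)
Definition cleared_grad x := tform B x *: tgrad T x - tform T x *: tgrad B x.

Lemma quot_gradE x : on_sphere x -> g x = (k%:R / tform B x ^+ 2) *: cleared_grad x.
Proof.
move=> x1; have Bx : tform B x != 0 by rewrite gt_eqF// posB// on_sphere_neq0.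
rewrite /quot_grad /cleared_grad !scalerBr !scalerA; congr (_ *: _ - _ *: _); by field.
Qed.

Lemma cleared_grad_le : exists2 r, 0 < r &
  forall x, on_sphere x -> r * enorm (cleared_grad x) <= enorm (g x).
Proof.
have sB := tensor_sum_ge0 B; pose b := tensor_sum B + 1.
have b0 : 0 < b by rewrite ltr_wpDl.
exists (k%:R / b ^+ 2); first by rewrite divr_gt0 ?ltr0n// exprn_gt0.
move=> x x1; have Bx : 0 < tform B x by rewrite posB// on_sphere_neq0.
rewrite quot_gradE// enormZ ler_wpM2r ?enorm_ge0//.
rewrite ger0_norm ?divr_ge0 ?exprn_ge0 ?(ltW Bx)// ler_wpM2l//.
rewrite lef_pV2 ?posrE ?exprn_gt0// lerXn2r ?nnegrE ?(ltW Bx) ?(ltW b0)//.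
rewrite (le_trans (ler_norm _))// (le_trans (tform_le _ (fun i => coord_sphere i x1)))//.
by rewrite lerDl.
Qed.

Lemma polynomial_cleared_grad :
  polynomial_fun (fun x => dot (cleared_grad x) (cleared_grad x)).
Proof.
suff pc i : polynomial_fun (fun x => cleared_grad x i 0) by exact: polynomial_dot.
rewrite (_ : (fun x => _) = fun x => tform B x * tgrad T x i 0
    + (-1) * tform T x * tgrad B x i 0); last first.
  by apply/funext => x; rewrite !mxE mulN1r mulNr.
have c1 := polynomial_cst (n := n) (-1 : R).
have [pT pB] := (polynomial_tform T, polynomial_tform B).
apply: polynomialD; apply: polynomialM => //; try exact: polynomial_tgrad.
exact: polynomialM.
Qed.

Lemma quot_level (t : R) : [set x | on_sphere x /\ f x = t] =
  [set x | on_sphere x] `&` [set x | tform T x + (- t) * tform B x = 0].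
Proof.
apply/seteqP; split=> x /= [x1 fx]; split=> //;
  have Bx : tform B x != 0 by rewrite gt_eqF// posB// on_sphere_neq0.
  by rewrite -fx /quot mulNr divfK// subrr.
by apply: (mulIf Bx); rewrite /quot divfK//; move: fx; lra.
Qed.

Lemma quot_KL (fs : R) : exists (eps M : R) (psi : R -> R), [/\ 0 < eps,
  forall t, 0 < t < eps -> `|psi t| <= M
  & forall s t x, 0 < s -> s < t -> t < eps -> on_sphere x -> f x = fs + t ->
    0 < enorm (cleared_grad x) /\ t - s <= enorm (cleared_grad x) * (psi t - psi s)].
Proof.
have [b b0 bB] := posdef_sphere posB; have [M M0 fM] := quot_taylor.
have [dN cN] := polynomial_cleared_grad.
(* The first summand bounds [g] by [cleared_grad], the second is the Taylor constant; their sum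
   serves both terms of the expansion. *)
pose C := k%:R / b ^+ 2 + M.
have kb0 : 0 <= k%:R / b ^+ 2 by rewrite divr_ge0// exprn_ge0 ?ltW.
apply: (@definable_KL _ n [set x | on_sphere x] f _ fs C n%:R _ _ dN cN).
- move=> i off ioff; have [dS _] := polynomial_sphere (R := R) (n := n).
  have [[dT _] [dB _]] := (polynomial_tform T, polynomial_tform B).
  have dS0 : definable (fun e : seq R => dot (block (n := n) off e) (block off e) - 1 = 0).
    by apply: definable_eq; [exact: dS|exact: term_const].
  apply: definable_ext (definable_and dS0 (_ : definable (fun e =>
      tform T (block off e) * (tform B (block off e))^-1 = fs + e`_i))).
    move=> e; have /seteqP[s1 s2] := sphere_zeros (R := R) (n := n).
    by split=> -[e1 e2]; split=> //; [exact: s2|exact: s1].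
  apply: definable_eq; first by apply: term_mul; [exact: dT|apply: term_inv; exact: dB].
  by apply: term_add; [exact: term_const|exact: term_var].
- move=> t; rewrite quot_level; apply: compact_closedI; first exact: compact_sphere.
  apply: closed_zeros; apply: polynomialD; first exact: polynomial_tform.
  by apply: polynomialM; [exact: polynomial_cst|exact: polynomial_tform].
- by rewrite ltr_wpDl.
- move=> x y x1 y1; set D := l1norm (y - x).
  have eD : enorm (y - x) <= D by exact: enorm_le_l1norm.
  have D0 : 0 <= D by exact: l1norm_ge0.
  have By : 0 < tform B y by rewrite (lt_le_trans b0)// bB.
  have gy : enorm (g y) <= k%:R / b ^+ 2 * enorm (cleared_grad y).
    rewrite quot_gradE// enormZ ler_wpM2r ?enorm_ge0// ger0_norm; last first.
      by rewrite divr_ge0// exprn_ge0// ltW.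
    rewrite ler_wpM2l// lef_pV2 ?posrE ?exprn_gt0//.
    by rewrite lerXn2r ?nnegrE ?(ltW b0) ?(ltW By)// bB.
  (* The expansion is taken at [y] and read towards [x], since the gradient is wanted at [y]. *)
  have := fM y x y1 x1; rewrite -(opprB y x) enormN dotNr ler_norml => /andP[fxy _].
  have h1 : dot (g y) (y - x) <= k%:R / b ^+ 2 * enorm (cleared_grad y) * D.
    rewrite (le_trans (ler_norm _))// (le_trans (cauchy_schwarz _ _))//.
    by rewrite ler_pM ?enorm_ge0.
  have h2 : M * enorm (y - x) ^+ 2 <= M * D ^+ 2.
    by rewrite ler_wpM2l ?(ltW M0)// lerXn2r ?nnegrE ?enorm_ge0.
  have h3 : 0 <= M * (enorm (cleared_grad y) * D).
    by rewrite mulr_ge0 ?(ltW M0)// mulr_ge0 ?enorm_ge0.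
  have h4 : 0 <= k%:R / b ^+ 2 * D ^+ 2 := mulr_ge0 kb0 (sqr_ge0 _).
  rewrite -/(enorm (cleared_grad y)) /C; lra.
- by move=> x; exact: l1norm_sphere.
Qed.

End Quotient.

(** * L-BFGS matrices *)

Section LBFGSBounds.
Context {R : realType} {n : nat}.
Implicit Types (y s z : 'cV[R]_n) (H : 'M[R]_n).

Definition mx_bounds a b H :=
  (forall z, a * dot z z <= dot z (H *m z)) /\ (forall z, enorm (H *m z) <= b * enorm z).

Lemma mulmx_outer y s z : (y *m s^T) *m z = dot s z *: y.
Proof. by rewrite -mulmxA [s^T *m z]mx11_scalar mul_mx_scalar. Qed.

Lemma mulmx_id_sub_outer r y s z :
  (1%:M - r *: (y *m s^T)) *m z = z - (r * dot s z) *: y.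
Proof. by rewrite mulmxBl mul1mx -scalemxAl mulmx_outer scalerA. Qed.

Lemma enorm_id_sub_outer r y s z (K : R) : `|r| * (enorm y * enorm s) <= K ->
  enorm ((1%:M - r *: (y *m s^T)) *m z) <= (1 + K) * enorm z.
Proof.
move=> rK; rewrite mulmx_id_sub_outer (le_trans (enormD _ _))// enormN enormZ.
rewrite mulrDl mul1r lerD2l normrM.
have := ler_wpM2r (enorm_ge0 z) rK; apply: le_trans.
have := ler_wpM2r (enorm_ge0 y) (ler_wpM2l (normr_ge0 r) (cauchy_schwarz s z)).
by move/le_trans; apply; rewrite le_eqVlt; apply/orP; left; apply/eqP; ring.
Qed.

(** Below: [z] is [V z] plus a multiple of [y]; the first part is controlled by [H], the second by
    the rank-one term, since [r ^+ 2 <= r / kappa]. Above: [V] has operator norm at most [1 + K].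
    Requiring [a' <= a] and [b <= b'] lets the new bounds also cover matrices left unchanged. *)
Lemma bfgs_update_bounds (kappa Y S a b : R) : 0 < kappa -> 0 <= Y -> 0 <= S -> 0 < a -> 0 < b ->
  exists a' b', [/\ 0 < a' <= a, b <= b' & forall y s r H,
    enorm y <= Y -> enorm s <= S -> 0 <= r <= kappa^-1 -> mx_bounds a b H ->
    mx_bounds a' b' ((1%:M - r *: (y *m s^T))^T *m H *m (1%:M - r *: (y *m s^T))
                     + r *: (s *m s^T))].
Proof.
move=> kappa0 Y0 S0 a0 b0.
(* [q] bounds [dot z z] by the updated quadratic form; the factors 2 come from the square of a sum
   of two vectors. *)
pose K := kappa^-1 * (Y * S); pose q := 2 / a + 2 * Y ^+ 2 / kappa.
have K0 : 0 <= K by rewrite !mulr_ge0// invr_ge0 ltW.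
have Y2 : 0 <= 2 * Y ^+ 2 / kappa by rewrite divr_ge0 ?(ltW kappa0)// mulr_ge0 ?sqr_ge0.
have a2 : 0 < 2 / a by rewrite divr_gt0.
have q0 : 0 < q by rewrite ltr_pwDl.
exists q^-1, ((1 + K) ^+ 2 * b + kappa^-1 * S ^+ 2); split.
- rewrite invr_gt0 q0/= invf_ple ?posrE// /q (_ : 2 / a = a^-1 + a^-1); last by ring.
  by rewrite -addrA lerDl addr_ge0// invr_ge0 ltW.
- have K1 : 0 <= (1 + K) ^+ 2 - 1 by rewrite (_ : _ - 1 = 2 * K + K ^+ 2); [rewrite addr_ge0 ?sqr_ge0// mulr_ge0|ring].
  have h : 0 <= ((1 + K) ^+ 2 - 1) * b by rewrite mulr_ge0// ltW.
  have h' : 0 <= kappa^-1 * S ^+ 2 by rewrite mulr_ge0 ?sqr_ge0// invr_ge0 ltW.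
  lra.
move=> y s r H yY sS /andP[r0 rk] [Ha Hb].
set V := 1%:M - _; have rK : `|r| * (enorm y * enorm s) <= K.
  by rewrite ger0_norm// ler_pM// ?mulr_ge0 ?enorm_ge0// ler_pM ?enorm_ge0.
have rK' : `|r| * (enorm s * enorm y) <= K by rewrite (mulrC (enorm s)).
have VT : V^T = 1%:M - r *: (s *m y^T).
  by rewrite /V linearB/= trmx1 linearZ/= trmx_mul trmxK.
have HE z : (V^T *m H *m V + r *: (s *m s^T)) *m z = V^T *m (H *m (V *m z)) + (r * dot s z) *: s.
  by rewrite mulmxDl -!mulmxA -scalemxAl mulmx_outer scalerA.
split=> z; rewrite HE.
  rewrite dotDr dot_mulmxr trmxK dotZr (dotC z s) ler_pdivrMl//.
  have zE : z = V *m z + (r * dot s z) *: y by rewrite mulmx_id_sub_outer subrK.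
  have h1 : dot z z <= 2 * dot (V *m z) (V *m z) + 2 * (r * dot s z) ^+ 2 * dot y y.
    rewrite {1 2}zE; set v := V *m z; set t := r * dot s z.
    have := dot_ge0 (v - t *: y).
    rewrite !(dotDl, dotDr, dotNl, dotNr, dotZl, dotZr) (dotC y v); lra.
  have h2 : dot (V *m z) (V *m z) <= a^-1 * dot (V *m z) (H *m (V *m z)).
    by rewrite ler_pdivlMl.
  have h3 : dot y y <= Y ^+ 2 by rewrite -sqr_enorm lerXn2r ?nnegrE ?enorm_ge0.
  have h4 : (r * dot s z) ^+ 2 * dot y y <= Y ^+ 2 / kappa * (r * dot s z ^+ 2).
    rewrite (_ : _ * (r * _) = r * kappa^-1 * dot s z ^+ 2 * Y ^+ 2); last by ring.
    apply: ler_pM; rewrite ?sqr_ge0 ?dot_ge0// exprMn ler_wpM2r ?sqr_ge0// expr2.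
    by rewrite ler_wpM2l.
  have h5 : 0 <= dot (V *m z) (H *m (V *m z)).
    by apply: le_trans (Ha _); rewrite mulr_ge0 ?dot_ge0// ltW.
  have h6 : 0 <= r * dot s z ^+ 2 by rewrite mulr_ge0 ?sqr_ge0.
  have h7 : 0 <= 2 / a * (r * dot s z ^+ 2) := mulr_ge0 (ltW a2) h6.
  have h8 := mulr_ge0 Y2 h5.
  rewrite (_ : r * dot s z * dot s z = r * dot s z ^+ 2); last by ring.
  rewrite /q mulrDr; move: h1 h2 h4 h7 h8.
  move: (dot _ (H *m _)) (dot (V *m z) _) (r * dot s z ^+ 2) => A1 A2 A3.
  rewrite -(mulrA 2 _ (dot y y)); move: (_ ^+ 2 * dot y y) => A4; lra.
rewrite (le_trans (enormD _ _))// mulrDl lerD//.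
  rewrite VT (le_trans (enorm_id_sub_outer _ rK'))// expr2 -!mulrA ler_wpM2l ?addr_ge0//.
  rewrite (le_trans (Hb _))// mulrCA ler_wpM2l ?(ltW b0)//.
  exact: enorm_id_sub_outer.
rewrite enormZ normrM (ger0_norm r0) -!mulrA ler_pM//.
  by rewrite mulr_ge0 ?enorm_ge0.
rewrite (le_trans (ler_wpM2r (enorm_ge0 s) (cauchy_schwarz s z)))// mulrAC -expr2.
by rewrite [leRHS]mulrA -expr2 ler_wpM2r ?enorm_ge0// lerXn2r ?nnegrE ?enorm_ge0.
Qed.

Variables (g : 'cV[R]_n -> 'cV[R]_n) (x : nat -> 'cV[R]_n) (kappa Y S : R).
Variables (L : nat) (gamma : nat -> R).
Hypotheses (kappa_gt0 : 0 < kappa) (Y_ge0 : 0 <= Y) (S_ge0 : 0 <= S).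
Hypothesis yY : forall j, (1 <= j)%N -> enorm (yvec g x j) <= Y.
Hypothesis sS : forall j, (1 <= j)%N -> enorm (svec x j) <= S.
Hypothesis gammaP : gamma_rule g x kappa gamma.

Lemma rho_bounds j : 0 <= rho g x kappa j <= kappa^-1.
Proof.
rewrite /rho; case: ifP => [h|_]; last by rewrite lexx invr_ge0 ltW.
have ys0 := lt_le_trans kappa_gt0 h.
by rewrite invr_ge0 (ltW ys0)/= lef_pV2 ?posrE.
Qed.

(** Cauchy-Schwarz orders the three scalings, with [enorm s / enorm y] in the middle, so only the
    outer two need bounds. The extra [kappa] and 1 in the constants make them enclose the value 1 as
    well. *)
Lemma gamma_bounds : exists a b, [/\ 0 < a, 0 < b
  & forall c, (1 <= c)%N -> a <= gamma c <= b].
Proof.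
have Y2 : 0 < kappa + Y ^+ 2 by rewrite ltr_pwDl// sqr_ge0.
have S2 : 0 <= S ^+ 2 / kappa by rewrite divr_ge0 ?sqr_ge0// ltW.
exists (kappa / (kappa + Y ^+ 2)), (1 + S ^+ 2 / kappa); split.
- by rewrite divr_gt0.
- by rewrite ltr_pwDl.
case: gammaP => g1 gP; case=> [//|[|c]] _.
  by rewrite g1 lerDl S2 ler_pdivrMr// mul1r lerDl sqr_ge0.
have := gP c.+2 isT; rewrite /=; case: ifP => [_ ->|/negbT].
  by rewrite lerDl S2 ler_pdivrMr// mul1r lerDl sqr_ge0.
rewrite -leNgt; set y := yvec _ _ _; set s := svec _ _ => kys.
have yY' : enorm y <= Y by exact: yY.
have sS' : enorm s <= S by exact: sS.
have cs := le_trans (ler_norm _) (cauchy_schwarz y s).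
have ys0 := lt_le_trans kappa_gt0 kys.
have y0 : 0 < enorm y.
  rewrite lt_neqAle enorm_ge0 andbT eq_sym; apply/negP => /eqP y0.
  by move: (lt_le_trans ys0 cs); rewrite y0 mul0r ltxx.
have s0 : 0 < enorm s.
  rewrite lt_neqAle enorm_ge0 andbT eq_sym; apply/negP => /eqP s0.
  by move: (lt_le_trans ys0 cs); rewrite s0 mulr0 ltxx.
have m1 : kappa / (kappa + Y ^+ 2) <= dot y s / enorm y ^+ 2.
  apply: ler_pM; rewrite ?invr_ge0 ?(ltW kappa_gt0) ?(ltW Y2)//.
  rewrite lef_pV2 ?posrE ?exprn_gt0// ler_wpDl ?(ltW kappa_gt0)//.
  by rewrite lerXn2r ?nnegrE ?(ltW y0).
have m2 : dot y s / enorm y ^+ 2 <= enorm s / enorm y.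
  by rewrite expr2 invfM mulrA ler_wpM2r ?invr_ge0 ?(ltW y0)// ler_pdivrMr// mulrC.
have m3 : enorm s / enorm y <= enorm s ^+ 2 / dot y s.
  rewrite expr2 -mulrA ler_wpM2l ?(ltW s0)// ler_pdivlMr// mulrC ler_pdivrMr//.
  by rewrite mulrC.
have m4 : enorm s ^+ 2 / dot y s <= 1 + S ^+ 2 / kappa.
  rewrite ler_wpDl//; apply: ler_pM; rewrite ?sqr_ge0 ?invr_ge0 ?(ltW ys0)//.
    by rewrite lerXn2r ?nnegrE ?(ltW s0).
  by rewrite lef_pV2 ?posrE.
case=> ->; apply/andP; split=> //.
- exact: le_trans m2 (le_trans m3 m4).
- exact: le_trans m1 (le_trans m2 m3).
- exact: le_trans m1 m2.
- exact: le_trans m3 m4.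
Qed.

(** The bounds worsen at each of the [L] updates, a number independent of [c], so they are uniform
    in [c]. *)
Lemma lbfgs_bounds : exists a b, [/\ 0 < a, 0 < b
  & forall c, (1 <= c)%N -> mx_bounds a b (lbfgs g x kappa L gamma c)].
Proof.
rewrite /lbfgs; suff : forall m, (m <= L)%N -> exists a b, [/\ 0 < a, 0 < b
    & forall c, (1 <= c)%N -> mx_bounds a b (lbfgs_iter g x kappa L gamma c m)].
  by apply.
elim=> [_|m IHm mL] /=.
  have [a [b [a0 b0 gab]]] := gamma_bounds; exists a, b; split=> // c c1.
  have /andP[ag gb] := gab c c1.
  split=> z; rewrite mul_scalar_mx.
    by rewrite dotZr ler_wpM2r ?dot_ge0.
  by rewrite enormZ ger0_norm ?ler_wpM2r ?enorm_ge0// (le_trans _ ag)// ltW.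
have [a [b [a0 b0 ab]]] := IHm (ltnW mL).
have [a' [b' [/andP[a'0 aa'] bb' up]]] := bfgs_update_bounds kappa_gt0 Y_ge0 S_ge0 a0 b0.
exists a', b'; split=> //; first exact: lt_le_trans bb'.
move=> c c1; have [lo hi] := ab c c1; case: ifP => Lmc.
  have cL : (1 <= c - (L - m))%N by rewrite subn_gt0.
  by apply: up => //; [exact: yY|exact: sS|exact: rho_bounds].
split=> z; first by apply: le_trans (lo z); rewrite ler_wpM2r ?dot_ge0.
by apply: le_trans (hi z) _; rewrite ler_wpM2r ?enorm_ge0.
Qed.

Lemma direction_bounds : exists a b, [/\ 0 < a, 0 < b
  & forall c, (1 <= c)%N ->
    let p := direction g x kappa L gamma c in
    dot p (g (x c)) <= - (a * enorm (g (x c)) ^+ 2) /\ enorm p <= b * enorm (g (x c))].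
Proof.
have [a [b [a0 b0 ab]]] := lbfgs_bounds; exists a, b; split=> // c c1 /=.
have [lo hi] := ab c c1; rewrite /direction dotNl enormN lerN2 dotC sqr_enorm.
by split.
Qed.

End LBFGSBounds.

(** * The search curve on the sphere *)

Section Curve.
Context {R : realType} {n : nat}.
Variables (x p : 'cV[R]_n) (alpha : R).
Hypothesis x1 : on_sphere x.

Let u := alpha * dot x p.
Let q := enorm (alpha *: p) ^+ 2.

(** [q - u ^+ 2] is [alpha ^+ 2] times the squared norm of the part of [p] orthogonal to [x]. The
    curve is a Cayley transform: it rotates [x] in the plane of [x] and [p] by an angle whose half
    has squared tangent [q - u ^+ 2]. *)
Lemma curve_denom_ge1 : 1 <= 1 + q - u ^+ 2.
Proof.
rewrite -addrA lerDl subr_ge0 /u -dotZr -(real_normK (num_real (dot _ _))) /q.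
rewrite lerXn2r ?nnegrE ?enorm_ge0//.
by rewrite (le_trans (cauchy_schwarz _ _))// x1 mul1r.
Qed.

Let denom_neq0 : 1 + q - u ^+ 2 != 0.
Proof. by rewrite gt_eqF// (lt_le_trans _ curve_denom_ge1). Qed.

Let dotpp : alpha ^+ 2 * dot p p = q.
Proof. by rewrite /q sqr_enorm dotZl dotZr expr2 mulrA. Qed.

Lemma curve_dot v : dot v (curve x p alpha) =
  (((1 - u) ^+ 2 - q) * dot v x + 2 * alpha * dot v p) / (1 + q - u ^+ 2).
Proof. by rewrite /curve -/u -/q dotZr dotDr !dotZr mulrC. Qed.

Lemma curve_on_sphere : on_sphere (curve x p alpha).
Proof.
apply/on_sphereE; rewrite curve_dot (dotC _ x) (dotC _ p) !curve_dot (dotC p x).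
have /on_sphereE -> := x1.
apply: (mulIf denom_neq0); rewrite divfK// mul1r.
apply: (mulIf denom_neq0); rewrite mulrDl !mulrA -!mulrA !(mulVf denom_neq0) !mulr1.
move: dotpp; rewrite /u; move: (dot x p) (dot p p) q => d w q' <-; ring.
Qed.

Lemma curve_step : enorm (curve x p alpha - x) <= 2 * enorm (alpha *: p).
Proof.
apply: enorm_le; first by rewrite mulr_ge0 ?enorm_ge0.
have /on_sphereE xx := x1; have /on_sphereE cc := curve_on_sphere.
rewrite !(dotDl, dotDr, dotNl, dotNr) cc xx opprK (dotC _ x).
rewrite exprMn -/q.
have q0 : 0 <= q by exact: sqr_ge0.
(* The squared chord of the rotation, four times the squared sine of the half-angle. *)
rewrite (_ : _ + _ = 4 * (q - u ^+ 2) / (1 + q - u ^+ 2)).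
  rewrite ler_pdivrMr ?(lt_le_trans _ curve_denom_ge1)//.
  have h := curve_denom_ge1; have u0 : 0 <= u ^+ 2 by exact: sqr_ge0.
  have : 0 <= q * (q - u ^+ 2) by rewrite mulr_ge0//; lra.
  lra.
rewrite curve_dot xx; move: denom_neq0; rewrite /u => d0; field.
exact: d0.
Qed.

End Curve.

(** * Iterates of CEST *)

Section FiniteLengthLimit.
Context {R : realType} {n : nat}.

Lemma cvg_coord (X : nat -> 'cV[R]_n) (l : 'cV[R]_n) :
  (forall i, X c i 0 @[c --> \oo] --> l i 0) -> X @ \oo --> l.
Proof.
move=> Xl; apply/cvg_ballP => e e0.
have near_i i : \forall c \near \oo, ball (l i 0) e (X c i 0).
  by move/cvg_ballP : (Xl i) => /(_ _ e0).
have near_all : \forall c \near \oo, forall i, ball (l i 0) e (X c i 0).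
  exact: filter_forall near_i.
apply: filterS near_all => c h; split=> // i j; rewrite (ord1 j).
exact: h.
Qed.

(** The increments of each coordinate are dominated by the lengths, so their series converges
    absolutely. *)
Lemma finite_length_cvg (X : nat -> 'cV[R]_n) A :
  (forall m, \sum_(0 <= c < m) enorm (X c.+1 - X c) <= A) ->
  exists l : 'cV[R]_n, X @ \oo --> l.
Proof.
move=> XA; pose u i c := X c.+1 i 0 - X c i 0.
have su i : cvgn (series (u i)).
  apply: normed_cvg; apply: nondecreasing_is_cvgn.
    by apply: nondecreasing_series => c _ _; exact: normr_ge0.
  exists A => _ [m _ <-]; apply: (le_trans _ (XA m)); apply: ler_sum => c _.
  by have := coord_le_enorm (X c.+1 - X c) i; rewrite !mxE.
exists (\col_i (X 0%N i 0 + limn (series (u i)))); apply: cvg_coord => i.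
rewrite mxE (_ : (fun c => X c i 0) = (fun c => X 0%N i 0 + series (u i) c)).
  by apply: cvgD; [exact: cvg_cst|exact: su].
apply/funext; elim=> [|c IHc]; first by rewrite /series/= big_geq// addr0.
by rewrite /series/= big_nat_recr//= addrA -[X in X + _]IHc /u subrKC.
Qed.

Lemma nneseries_lty (len : nat -> R) A : (forall c, 0 <= len c) ->
  (forall m, \sum_(0 <= c < m) len c.+1 <= A) ->
  (\sum_(1 <= c <oo) (len c)%:E < +oo)%E.
Proof.
move=> len0 lenA; apply: (@le_lt_trans _ _ A%:E); last exact: ltry.
apply: lime_le; first by apply: is_cvg_nneseries => c _ _; rewrite lee_fin.
apply: nearW => m; rewrite sumEFin lee_fin.
case: m => [|m]; first by rewrite big_geq// (le_trans _ (lenA 0%N))// big_geq.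
by rewrite big_add1.
Qed.

End FiniteLengthLimit.

Section Iterates.
Context {R : realType} {k n : nat} (T B : tensor R k n).
Hypotheses (k_gt0 : (0 < k)%N) (symT : tensor_sym T) (symB : tensor_sym B)
  (posB : tensor_posdef B).
Variables (L : nat) (eta beta kappa : R) (gamma : nat -> R) (x : nat -> 'cV[R]_n).
Hypotheses (eta01 : 0 < eta < 1) (beta01 : 0 < beta < 1) (kappa_gt0 : 0 < kappa).
Hypothesis xP : CEST_infinite T B L eta beta kappa gamma x.

Local Notation f := (quot T B).
Local Notation g := (quot_grad T B).
Local Notation p := (direction g x kappa L gamma).

Lemma iterates_on_sphere c : (1 <= c)%N -> on_sphere (x c).
Proof.
case: xP => x1 _ _ step; elim: c => [//|[//|c] IHc _].
by have [l [_ _ ->]] := step c.+1 isT; exact/curve_on_sphere/IHc.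
Qed.

Lemma iterates_direction : exists a b, [/\ 0 < a, 0 < b & forall c, (1 <= c)%N ->
  dot (p c) (g (x c)) <= - (a * enorm (g (x c)) ^+ 2) /\ enorm (p c) <= b * enorm (g (x c))].
Proof.
have [G G0 gG] := quot_grad_le T posB; case: xP => _ gammaP _ _.
apply: (@direction_bounds _ _ _ _ _ (G + G) 2) => //; first by rewrite addr_ge0// ltW.
- move=> j j1; rewrite (le_trans (enormD _ _))// enormN lerD// gG//;
    exact: iterates_on_sphere.
- move=> j j1; rewrite (le_trans (enormD _ _))// enormN.
  by rewrite !iterates_on_sphere.
Qed.

Lemma grad_neq0 c : (1 <= c)%N -> 0 < enorm (g (x c)).
Proof.
move=> c1; rewrite lt_neqAle enorm_ge0 andbT eq_sym; apply/negP => /eqP/enorm_eq0.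
by case: xP => _ _ /(_ c c1).
Qed.

(* Since g(x) is orthogonal to x, the curve has g-slope 2 (p . g) / denominator,
   at least as steep as p . g as long as the step is at most 1. *)
Lemma armijo_small_step : exists2 M, 0 < M & forall c alpha, (1 <= c)%N -> 0 <= alpha ->
  dot (p c) (g (x c)) <= 0 -> enorm (alpha *: p c) <= 1 ->
  f (curve (x c) (p c) alpha) <= f (x c) + alpha * dot (p c) (g (x c))
     + M * enorm (alpha *: p c) ^+ 2.
Proof.
have [M M0 fM] := quot_taylor symT symB posB.
(* The chord is at most twice [enorm (alpha *: p c)], hence the factor 4. *)
exists (4 * M); first by rewrite mulr_gt0.
move=> c alpha c1 alpha0 pg0 q1; have xc := iterates_on_sphere c1.
have := fM _ _ xc (curve_on_sphere (p c) alpha xc).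
have := curve_step (p c) alpha xc; set s := curve _ _ _ - _ => s2.
have gs : dot (g (x c)) s <= alpha * dot (p c) (g (x c)).
  rewrite /s dotDr dotNr curve_dot quot_grad_euler// mulr0 add0r subr0 (dotC (g _)).
  have den1 := curve_denom_ge1 (p c) alpha xc.
  have den2 : 1 + enorm (alpha *: p c) ^+ 2 - (alpha * dot (x c) (p c)) ^+ 2 <= 2.
    have : enorm (alpha *: p c) ^+ 2 <= 1 by rewrite expr_le1// enorm_ge0.
    by have := sqr_ge0 (alpha * dot (x c) (p c)); lra.
  move: den1 den2; set d := 1 + _ - _ => den1 den2.
  rewrite ler_pdivrMr ?(lt_le_trans _ den1)//.
  have : 0 <= - (alpha * dot (p c) (g (x c))) * (2 - d).
    by rewrite mulr_ge0 ?subr_ge0// -mulrN mulr_ge0// oppr_ge0.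
  lra.
rewrite ler_norml => /andP[_ h].
have : M * enorm s ^+ 2 <= M * (2 * enorm (alpha *: p c)) ^+ 2.
  by rewrite ler_wpM2l ?(ltW M0)// lerXn2r ?nnegrE ?enorm_ge0// mulr_ge0 ?enorm_ge0.
rewrite exprMn; move: h gs; rewrite /s; lra.
Qed.

(** Either the trial step 1 is accepted, or the accepted step is [beta] times a rejected one. A
    rejected step is at least [t1] if it moves by more than 1, since directions have norm at most
    [b * G]; otherwise its rejection contradicts [armijo_small_step] unless it is at least [t2]. *)
Lemma step_length : exists2 alpha0, 0 < alpha0 & forall c, (1 <= c)%N ->
  exists alpha, [/\ alpha0 <= alpha, x c.+1 = curve (x c) (p c) alpha
    & armijo T B eta (x c) (p c) alpha].
Proof.
have [a [b [a0 b0 ab]]] := iterates_direction.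
have [M M0 small] := armijo_small_step; have [G G0 gG] := quot_grad_le T posB.
have [/andP[eta0 eta1] /andP[beta0 beta1]] := (eta01, beta01).
pose t1 := (b * G)^-1; pose t2 := (1 - eta) * a / (M * b ^+ 2).
have t10 : 0 < t1 by rewrite invr_gt0 mulr_gt0.
have t20 : 0 < t2 by rewrite divr_gt0 ?mulr_gt0 ?subr_gt0 ?exprn_gt0.
exists (Num.min 1 (beta * Num.min t1 t2)); first by rewrite lt_min ltr01 mulr_gt0// lt_min t10.
move=> c c1; case: xP => _ _ _ /(_ c c1)[l [arm fail xc1]].
exists (beta ^+ l); split=> //; case: l fail {arm xc1} => [|l] fail.
  by rewrite expr0 ge_min lexx.
rewrite exprS ge_min; apply/orP; right; rewrite ler_pM2l//.
have := fail l (ltnSn l); rewrite /armijo -ltNge => {fail}.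
set alpha := beta ^+ l; set pc := p c; set gc := g (x c) => fail.
have alpha0 : 0 < alpha by exact: exprn_gt0.
have [pg pb] := ab c c1; rewrite -/pc -/gc in pg pb.
have gc0 : 0 < enorm gc by exact: grad_neq0.
have gcG : enorm gc <= G by apply: gG; exact: iterates_on_sphere.
rewrite ge_min; have [q1|q1] := leP (enorm (alpha *: pc)) 1; apply/orP; [right|left].
  have pg0 : dot pc gc <= 0.
    by apply: le_trans pg _; rewrite oppr_le0 mulr_ge0 ?sqr_ge0 ?(ltW a0).
  have := small c alpha c1 (ltW alpha0) pg0 q1; rewrite -/pc -/gc => up.
  have h1 : (1 - eta) * - dot pc gc < M * alpha * enorm pc ^+ 2.
    rewrite -(ltr_pM2l alpha0); have := lt_le_trans fail up.
    rewrite enormZ (gtr0_norm alpha0) exprMn; lra.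
  have h2 : (1 - eta) * (a * enorm gc ^+ 2) <= (1 - eta) * - dot pc gc.
    by rewrite ler_wpM2l ?subr_ge0 ?(ltW eta1)//; lra.
  have h3 : M * alpha * enorm pc ^+ 2 <= M * alpha * (b * enorm gc) ^+ 2.
    by rewrite ler_wpM2l ?mulr_ge0 ?(ltW M0) ?(ltW alpha0)// lerXn2r ?nnegrE ?enorm_ge0// mulr_ge0 ?enorm_ge0 ?(ltW b0).
  have := le_lt_trans h2 (lt_le_trans h1 h3).
  rewrite exprMn [ltLHS]mulrA [ltRHS]mulrA ltr_pM2r ?exprn_gt0// => h4.
  rewrite /t2 ler_pdivrMr ?mulr_gt0 ?exprn_gt0//; lra.
rewrite /t1 -[leLHS]mul1r ler_pdivrMr ?mulr_gt0//.
apply: (le_trans (ltW q1)); rewrite enormZ (gtr0_norm alpha0) ler_pM2l//.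
by apply: le_trans pb _; rewrite ler_pM2l.
Qed.

(** The first bound serves stationarity, the second the length. In the second, [alpha] is a factor
    of both the decrease and the bound on the chord, and cancels. *)
Lemma sufficient_decrease : exists e1 e2, [/\ 0 < e1, 0 < e2 & forall c, (1 <= c)%N ->
  e1 * enorm (g (x c)) ^+ 2 <= f (x c) - f (x c.+1) /\
  e2 * enorm (g (x c)) * enorm (x c.+1 - x c) <= f (x c) - f (x c.+1)].
Proof.
have [a [b [a0 b0 ab]]] := iterates_direction; have [alpha0 al0 step] := step_length.
have /andP[eta0 _] := eta01.
exists (eta * alpha0 * a), (eta * a / (2 * b)); split; rewrite ?divr_gt0 ?mulr_gt0//.
move=> c c1; have [alpha [le_al xc1 arm]] := step c c1; have [pg pb] := ab c c1.
have al : 0 < alpha by exact: lt_le_trans le_al.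
have armE : eta * alpha * - dot (p c) (g (x c)) <= f (x c) - f (x c.+1).
  by move: arm; rewrite /armijo -xc1; lra.
have ea : 0 < eta * alpha by rewrite mulr_gt0.
have dec : eta * alpha * (a * enorm (g (x c)) ^+ 2) <= f (x c) - f (x c.+1).
  by apply: le_trans armE; rewrite ler_pM2l//; lra.
split; apply: le_trans dec.
  rewrite -!mulrA ler_pM2l// ler_wpM2r// mulr_ge0 ?sqr_ge0 ?(ltW a0)//.
have := curve_step (p c) alpha (iterates_on_sphere c1).
rewrite -xc1 enormZ (gtr0_norm al) => sc.
have {}sc : enorm (x c.+1 - x c) <= 2 * (alpha * (b * enorm (g (x c)))).
  by rewrite (le_trans sc)// ler_pM2l// ler_pM2l.
have g0 : 0 <= eta * a / (2 * b) * enorm (g (x c)).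
  by rewrite mulr_ge0 ?enorm_ge0// divr_ge0// mulr_ge0// ltW.
apply: le_trans (ler_wpM2l g0 sc) _.
rewrite le_eqVlt; apply/orP; left; apply/eqP; field.
by rewrite gt_eqF.
Qed.

Lemma iterates_finite_length : exists A, forall m,
  \sum_(0 <= c < m) enorm (x c.+2 - x c.+1) <= A.
Proof.
have [e1 [e2 [e10 e20 dec]]] := sufficient_decrease.
have [r r0 rg] := cleared_grad_le T k_gt0 posB; have [Q Q0 fQ] := quot_le T posB.
(* The factor [r] passes from [g] to [cleared_grad], and the shift skips the meaningless index 0. *)
apply: (@finite_length _ _ (fun z => on_sphere z) f (fun z => enorm (cleared_grad T B z))
  (fun c => x c.+1) _ (e2 * r) (- Q)).
- exact: quot_KL.
- by move=> c; exact: iterates_on_sphere.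
- move=> c; have := fQ (x c.+1) (iterates_on_sphere (isT : (1 <= c.+1)%N)).
  by rewrite ler_norml => /andP[].
- move=> c; have [h _] := dec c.+1 isT; rewrite -subr_gt0.
  by apply: lt_le_trans h; rewrite mulr_gt0// exprn_gt0// grad_neq0.
- by rewrite mulr_gt0.
- move=> c; have [_ h] := dec c.+1 isT; apply: le_trans h.
  rewrite ler_wpM2r ?enorm_ge0// -mulrA ler_wpM2l ?(ltW e20)//.
  by apply: rg; exact: iterates_on_sphere.
- by move=> c; exact: enorm_ge0.
Qed.

Lemma limit_on_sphere (l : 'cV[R]_n) : (fun c => x c.+1) @ \oo --> l -> on_sphere l.
Proof.
move=> xl; have [_ cs] := polynomial_sphere (R := R) (n := n).
have := cvg_comp _ _ xl (cs l).
rewrite (_ : _ \o _ = fun=> 0); last first.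
  apply/funext => c /=.
  by have /on_sphereE -> := iterates_on_sphere (isT : (1 <= c.+1)%N); rewrite subrr.
move=> /(norm_cvg_unique (cvg_cst 0))/esym/eqP; rewrite subr_eq0 => /eqP.
by move/on_sphereE.
Qed.

(** The values of [f] converge, so their successive differences tend to 0; these dominate the
    squared norm of [cleared_grad], which is continuous and therefore vanishes at the limit. *)
Lemma limit_stationary (l : 'cV[R]_n) : (fun c => x c.+1) @ \oo --> l -> g l = 0.
Proof.
move=> xl; have l1 := limit_on_sphere xl.
have [e1 [e2 [e10 e20 dec]]] := sufficient_decrease.
have [r r0 rg] := cleared_grad_le T k_gt0 posB; have [Q Q0 fQ] := quot_le T posB.
pose N z := dot (cleared_grad T B z) (cleared_grad T B z).
have Nl : (fun c => N (x c.+1)) @ \oo --> N l.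
  by have [_ cN] := polynomial_cleared_grad T B; exact: cvg_comp xl (cN l).
pose a c := f (x c.+1).
have a_dec : nonincreasing_seq a.
  apply/nonincreasing_seqP => c; have [h _] := dec c.+1 isT; rewrite -subr_ge0.
  by apply: le_trans h; rewrite mulr_ge0 ?sqr_ge0// ltW.
have a_lb : has_lbound (range a).
  exists (- Q) => _ [c _ <-].
  have := fQ (x c.+1) (iterates_on_sphere (isT : (1 <= c.+1)%N)).
  by rewrite ler_norml => /andP[].
have a_cvg := nonincreasing_cvgn a_dec a_lb.
have a_cvgS : (fun c => a c.+1) @ \oo --> inf (range a) by rewrite cvg_shiftS.
have diff0 : (fun c => (e1 * r ^+ 2)^-1 * (a c - a c.+1)) @ \oo --> (0 : R).
  rewrite -(mulr0 (e1 * r ^+ 2)^-1) -(subrr (inf (range a))).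
  by apply: cvgM; [exact: cvg_cst|exact: cvgB].
have N0 : (fun c => N (x c.+1)) @ \oo --> (0 : R).
  apply: squeeze_cvgr (cvg_cst 0) diff0; apply: nearW => c; rewrite dot_ge0/=.
  have [h _] := dec c.+1 isT.
  rewrite ler_pdivlMl ?mulr_gt0 ?exprn_gt0//; apply: le_trans h.
  rewrite -mulrA ler_pM2l// /N -sqr_enorm -exprMn.
  rewrite lerXn2r ?nnegrE ?mulr_ge0 ?enorm_ge0 ?(ltW r0)//.
  by apply: rg; exact: iterates_on_sphere.
have /dot_eq0 w0 : N l = 0 by exact: norm_cvg_unique Nl N0.
by rewrite quot_gradE// w0 scaler0.
Qed.

End Iterates.

Unset Implicit Arguments.

Theorem theorem5p8 (R : realType) (k n : nat) (hk0 : (0 < k)%N)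
    (hk : ~~ odd k)
    (E : {set {set 'I_n}}) (hE : uniform_hypergraph k E)
    (T B : tensor R k n)
    (hT : [\/ T = adj_tensor R k E, T = lap_tensor R k E
            | T = slap_tensor R k E])
    (hBsym : tensor_sym B) (hBpos : tensor_posdef B)
    (L : nat) (hL : (0 < L)%N)
    (eta beta kappa : R)
    (heta : 0 < eta < 1) (hbeta : 0 < beta < 1) (hkappa : 0 < kappa < 1)
    (gamma : nat -> R) (x : nat -> 'cV[R]_n)
    (hx : CEST_infinite T B L eta beta kappa gamma x) :
  (\sum_(1 <= c <oo) (enorm (x c.+1 - x c))%:E < +oo)%E /\
  exists xs : 'cV[R]_n,
    [/\ x @ \oo --> xs,
        forall z : 'cV[R]_n, x @ \oo --> z -> z = xs
      & stationary T B xs].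
Proof.
have symT := hypergraph_tensor_sym hT; have kappa0 : 0 < kappa by case/andP: hkappa.
have [A xA] := iterates_finite_length hk0 symT hBsym hBpos heta hbeta kappa0 hx.
split; first exact: (nneseries_lty (fun c => enorm_ge0 (x c.+1 - x c)) xA).
have [xs xl] := finite_length_cvg (X := fun c => x c.+1) xA.
have xl' : x @ \oo --> xs by move: xl; rewrite cvg_shiftS.
exists xs; split=> //; first by move=> z xz; exact: norm_cvg_unique xz xl'.
split; first exact: limit_on_sphere hx _ xl.
exact: (limit_stationary hk0 symT hBsym hBpos heta hbeta kappa0 hx xl).
Qed.
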